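(* Let $(M,\mathcal T)$ be a triangulated compact pseudo 3-manifold with a $1$-$3$ type triangulation $\mathcal T$. Then a decorated $1$-$3$ type hyperbolic polyhedral metric on $(M,\mathcal T)$ is determined up to isometry and change of decorations by its curvature. That is: if $l_1,l_2\in\mathcal L(M,\mathcal T)\subset\mathbb R^{E}$ are (edge length vectors of) two decorated $1$-$3$ type hyperbolic polyhedral metrics on $(M,\mathcal T)$ with the same curvature, $K_{l_1}=K_{l_2}$, then there is a function $w:V\to\mathbb R$ with $w(v)=0$ for every hyperideal vertex $v$, such that $l_1(e)=l_2(e)+w(v)+w(v')$ for every edge $e\in E$ with end vertices $v,v'$.
   Context: Work in the Klein model, $\mathbb H^3$ = open unit ball in $\mathbb R^3\subset\mathbb RP^3$. A $1$-$3$ type hyperbolic tetrahedron is obtained from a (Euclidean/projective) tetrahedron with vertices $v_1,v_2,v_3,v_4$, where $v_1$ (the hyperideal vertex) lies outside the closed ball, $v_2,v_3,v_4$ (the ideal vertices) lie on $\partial\mathbb H^3$, and all six edges meet $\mathbb H^3$, by intersecting with $\mathbb H^3$ and truncating at $v_1$ by the hyperbolic plane dual to $v_1$ (the plane orthogonal to the three edges issuing from $v_1$). The truncated triangle and its sides are not counted among the faces and edges of the tetrahedron; the edges (internal edges) are $e_{ij}$, $1\le i<j\le 4$, with dihedral angles $\alpha_{ij}=\alpha_{ji}$. A decoration is a choice of a horosphere $H_i$ centered at each ideal vertex $v_i$, $i=2,3,4$. The edge lengths of a decorated tetrahedron are: for $i\neq j$ in $\{2,3,4\}$, $l_{ij}$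 is the signed distance along $e_{ij}$ between $H_i$ and $H_j$ (positive if $H_i,H_j$ are disjoint, $\le 0$ otherwise); for $i\in\{2,3,4\}$, $l_{1i}$ is the signed distance along $e_{1i}$ from the truncating plane to $H_i$ (positive iff the intersection point of $e_{1i}$ with the truncating plane is outside the horoball bounded by $H_i$). A triangulated compact pseudo 3-manifold $(M,\mathcal T)$ is the quotient of a finite disjoint union of tetrahedra by affine homeomorphisms identifying some of their faces in pairs; $V$ and $E$ are the sets of vertices and edges of $\mathcal T$. The triangulation is of $1$-$3$ type if each tetrahedron is combinatorially a $1$-$3$ type tetrahedron: one of its vertices is designated hyperideal and the other three ideal, and the gluings respect these designations. A decorated $1$-$3$ type hyperbolic polyhedral metric on $(M,\mathcal T)$ is obtained by replacing each tetrahedron by a decorated $1$-$3$ type hyperbolic tetrahedron and the affine gluings by isometries preserving decorations; equivalently it is a function $l:E\to\mathbb R$ whose restriction to the six edges of each tetrahedron is the edge length vector of a decorated $1$-$3$ type hyperbolic tetrahedron. $\mathcal L(M,\mathcal T)\subset\mathbb R^E$ is the set of all such $l$. The curvature $K_l:E\to\mathbb R$ of $l$ assigns to $e$ the number $2\pi$ (resp. $\pi$) minus the cone angle at $e$ (the sum of all dihedral angles at $e$ in the tetrahedra around $e$), if the gluing of tetrahedra around $e$ is cyclical (resp. not cyclical). A change of decorations changes $l$ by adding $w(v)+w(v')$ to the length of each edge with ends $v,v'$, where $w:V\to\mathbb R$ vanishes at hyperideal vertices. *)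

(* Defs.v *)
From HB Require Import structures.
From mathcomp Require Import all_boot all_order all_fingroup all_algebra.
From mathcomp Require Import all_classical all_reals all_analysis.

Set Implicit Arguments.
Unset Strict Implicit.
Unset Printing Implicit Defensive.

Import Order.TTheory GRing.Theory Num.Theory.

Local Open Scope classical_set_scope.
Local Open Scope ring_scope.

Section KleinModel.
Variable R : realType.
Implicit Types (x y p u w d v : 'rV[R]_3) (s t : R).

Definition dot x y : R := \sum_(k < 3) x 0 k * y 0 k.

Definition H3 : set 'rV[R]_3 := [set x | dot x x < 1].

Definition segment x y : set 'rV[R]_3 :=
  [set z | exists2 t, 0 <= t <= 1 & z = (1 - t) *: x + t *: y].

Definition arcosh t : R := ln (t + Num.sqrt (t ^+ 2 - 1)).

Definition hdist x y : R :=
  arcosh ((1 - dot x y) / Num.sqrt ((1 - dot x x) * (1 - dot y y))).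

(* The horospheres centered at a point v of the unit sphere are the level sets
   of the function x |-> (1 - x.v) / sqrt (1 - |x|^2), whose logarithm is a
   Busemann function at v; it tends to 0 as x tends to v along a geodesic. *)
Definition horosphere v s : set 'rV[R]_3 :=
  [set x | H3 x /\ 1 - dot x v = s * Num.sqrt (1 - dot x x)].

Definition closed_horoball v s : set 'rV[R]_3 :=
  [set x | H3 x /\ 1 - dot x v <= s * Num.sqrt (1 - dot x x)].

(* The hyperbolic plane dual to a point v outside the closed ball is cut out
   by the polar plane of v with respect to the unit sphere. *)
Definition dual_plane v : set 'rV[R]_3 := [set x | H3 x /\ dot x v = 1].

(* The hyperbolic Riemannian metric of the Klein model, at the point p. *)
Definition kmetric p u w : R :=
  dot u w / (1 - dot p p) + dot p u * dot p w / (1 - dot p p) ^+ 2.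

Definition orth_comp p d u : 'rV[R]_3 :=
  u - (kmetric p u d / kmetric p d d) *: d.

Definition kangle p u w : R :=
  acos (kmetric p u w / (Num.sqrt (kmetric p u u) * Num.sqrt (kmetric p w w))).

End KleinModel.

(* A decorated 1-3 type hyperbolic tetrahedron whose hyperideal vertex is the
   one labelled h.  The decoration at an ideal vertex i is the horosphere of
   parameter [hsize i] centered there; [hsize h] plays no role. *)
Record decorated_tetrahedron (R : realType) (h : 'I_4) := DecoratedTetrahedron {
  vtx : 'I_4 -> 'rV[R]_3;
  hsize : 'I_4 -> R;
  vtx_affinely_independent :
    row_free (\matrix_(i < 4) row_mx (vtx i) (1 : 'rV[R]_1));
  vtx_hyperideal : 1 < dot (vtx h) (vtx h);
  vtx_ideal : forall i, i != h -> dot (vtx i) (vtx i) = 1;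
  vtx_edges_meet_H3 :
    forall i j, i != j -> segment (vtx i) (vtx j) `&` @H3 R !=set0;
  hsize_gt0 : forall i, i != h -> 0 < hsize i
}.

Section Tetrahedron.
Variables (R : realType) (h : 'I_4) (P : decorated_tetrahedron R h).
Implicit Types i j : 'I_4.

(* A complete geodesic when i != j: the edges issuing from h are not truncated
   here, so that they meet the horospheres centered at their ideal ends even
   when these reach beyond the truncating plane. *)
Definition tetra_edge i j : set 'rV[R]_3 :=
  segment (vtx P i) (vtx P j) `&` @H3 R.

Definition end_surface i : set 'rV[R]_3 :=
  if i == h then dual_plane (vtx P i) else horosphere (vtx P i) (hsize P i).

(* The (unique) point where the edge ij crosses the horosphere at its end i,
   or the truncating plane if i is the hyperideal vertex. *)
Definition foot i j : 'rV[R]_3 := xget 0 (tetra_edge i j `&` end_surface i).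

Definition positive_length i j : Prop :=
  if i == h then ~ closed_horoball (vtx P j) (hsize P j) (foot i j)
  else if j == h then ~ closed_horoball (vtx P i) (hsize P i) (foot j i)
  else end_surface i `&` end_surface j = set0.

Definition edge_length i j : R :=
  if `[< positive_length i j >] then hdist (foot i j) (foot j i)
  else - hdist (foot i j) (foot j i).

(* The angle, at a point p of the edge ij, between the two faces containing
   that edge: [orth_comp] gives the tangent vectors at p which are orthogonal
   to the edge and point into the faces ijk and ijl.  It does not depend on p. *)
Definition dihedral_angle i j : R :=
  let others := enum (~: [set i; j])%SET in
  let k := nth i others 0 in
  let l := nth i others 1 in
  let p := xget 0 (tetra_edge i j) in
  let d := vtx P j - vtx P i in
  kangle p (orth_comp p d (vtx P k - p)) (orth_comp p d (vtx P l - p)).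

End Tetrahedron.

(* A triangulated compact pseudo 3-manifold.  The vertices of each tetrahedron
   are labelled by 'I_4, and its faces by the opposite vertices.  The value
   [mate t f = Some (t', g)] means that the face f of t is glued to the face
   g f of t' by the affine map which sends the vertex i of t to the vertex g i
   of t', for i != f; [None] means that the face is not glued. *)
Record triangulation := Triangulation {
  tetra : finType;
  mate : tetra -> 'I_4 -> option (tetra * {perm 'I_4});
  mate_sym : forall t f t' g,
    mate t f = Some (t', g) -> mate t' (g f) = Some (t, g^-1%g);
  mate_neq : forall t f t' g, mate t f = Some (t', g) -> (t', g f) != (t, f)
}.

(* A designation of the hyperideal vertex of each tetrahedron. *)
Record type13 (T : triangulation) := Type13 {
  hyper :> tetra T -> 'I_4;
  hyper_mate : forall t f t' g, mate t f = Some (t', g) ->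
    forall i, i != f -> (g i == hyper t') = (i == hyper t)
}.

Section Cells.
Variable T : triangulation.

(* Faces of the tetrahedra before gluing, given by their sets of vertices. *)
Definition simplex : finType := (tetra T * {set 'I_4})%type.

Definition glued : rel simplex := fun x y =>
  [exists f, if mate x.1 f is Some (t', g)
             then (f \notin x.2) && (y == (t', (g @: x.2)%SET)) else false].

Definition cell_class (x : simplex) : {set simplex} :=
  [set y | connect glued x y]%SET.

(* The cells of the quotient with n vertices, as equivalence classes. *)
Definition cell n : finType :=
  {C : {set simplex} | [exists x : simplex, (#|x.2| == n) && (C == cell_class x)]}.

Definition V := cell 1.
Definition E := cell 2.

Lemma vertex_subproof t i : let x : simplex := (t, [set i]%SET) in
  [exists y : simplex, (#|y.2| == 1%N) && (cell_class x == cell_class y)].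
Proof. by apply/existsP; exists (t, [set i]%SET); rewrite cards1 !eqxx. Qed.

Definition vertex t i : V := Sub (cell_class (t, [set i]%SET)) (vertex_subproof t i).

Definition in_edge (e : E) t i j : bool :=
  ((t, [set i; j]%SET) : simplex) \in val e.

(* The gluing around e is cyclical iff all the faces around e are glued. *)
Definition cyclical (e : E) : bool :=
  [forall x in val e, [forall f, (f \notin x.2) ==> (mate x.1 f != None)]].

Definition hyperideal_vertex (hyp : type13 T) (v : V) : bool :=
  [exists t, v == vertex t (hyp t)].

End Cells.

(* A decorated 1-3 type hyperbolic polyhedral metric: edge lengths [len]
   such that each tetrahedron is realized by a decorated hyperbolic tetrahedron
   having these edge lengths.  The set L(M,T) of R^E consists of the functions
   [len m]; equal lengths make the gluings isometries preserving decorations. *)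
Record polyhedral_metric (R : realType) (T : triangulation) (hyp : type13 T) :=
  PolyhedralMetric {
    len : E T -> R;
    realization : forall t, decorated_tetrahedron R (hyp t);
    lenP : forall e t i j,
      in_edge e t i j -> edge_length (realization t) i j = len e
  }.

Section Curvature.
Variables (R : realType) (T : triangulation) (hyp : type13 T).
Variable m : polyhedral_metric R hyp.

Definition cone_angle (e : E T) : R :=
  \sum_(t : tetra T) \sum_(i < 4) \sum_(j < 4 | (i < j)%N && in_edge e t i j)
    dihedral_angle (realization m t) i j.

Definition curvature (e : E T) : R :=
  (if cyclical e then 2 * pi else pi) - cone_angle e.

End Curvature.

(* Main.v *)
Require Import Defs.
From mathcomp Require Import all_boot all_order all_fingroup all_algebra.
From mathcomp Require Import all_classical all_reals all_analysis.
From mathcomp Require Import ring lra.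

Set Implicit Arguments.
Unset Strict Implicit.
Unset Printing Implicit Defensive.

Import Order.TTheory GRing.Theory Num.Theory.
Import numFieldNormedType.Exports.

Local Open Scope classical_set_scope.
Local Open Scope ring_scope.

(** Changing the decoration by w changes the pairing of length differences with
    angle differences by nothing, since the three dihedral angles at an ideal
    vertex add up to pi.  For a single tetrahedron one may thus move the
    horospheres until they touch the truncating plane; the three remaining
    lengths are then ln (x / 2), where 1 + x, 1 + y, 1 + z are the hyperbolic
    cosines of the sides of the truncation triangle, and in terms of the
    dihedral angles p, q, r at the edges between ideal vertices
      x / 2 = - sin (p + q + r) sin p / (sin (p + q) sin (p + r)).
    The map from (p, q, r) to the three lengths is strictly monotone on its
    convex domain because its Jacobian is symmetric and positive definite (it is
    minus the Hessian of twice the volume, by Schlaefli's formula, but the volume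
    itself is not needed).  Hence the sum over the edges of a tetrahedron of
    (l - l') (alpha - alpha') is nonnegative for any two tetrahedra, and it
    vanishes only if they differ by a change of decoration.  Summed over the
    triangulation, these pairings give the sum over the edges of (l - l') times
    the difference of the cone angles, which is 0 when the curvatures agree. *)

(** * Monotonicity of lengths in terms of angles *)

(** Sylvester's criterion for the symmetric matrix with diagonal [e1], [e2], [e3] and ones
    elsewhere: the first three hypotheses say that its leading minors are positive. Completing
    squares, with pivots [L] and [M], gives the proof. *)
Lemma quadratic_form_gt0 (F : realFieldType) (e1 e2 e3 x y z : F) :
  0 < e1 -> 1 < e1 * e2 -> 0 < e1 * e2 * e3 - e1 - e2 - e3 + 2 ->
  (x, y, z) != (0, 0, 0) ->
  0 < (x + y + z) ^+ 2 + (e1 - 1) * x ^+ 2 + (e2 - 1) * y ^+ 2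
      + (e3 - 1) * z ^+ 2.
Proof.
move=> e1_gt0 m_gt1 d_gt0 nz; set Q := (X in 0 < X).
have m_gt0 : 0 < e1 * e2 - 1 by rewrite subr_gt0.
set L := e1 * x + y + z; set M := (e1 * e2 - 1) * y + (e1 - 1) * z.
set d := (X in 0 < X) in d_gt0.
have QE : (e1 * e2 - 1) * (e1 * Q) =
    (e1 * e2 - 1) * L ^+ 2 + (M ^+ 2 + e1 * d * z ^+ 2).
  by rewrite /Q /L /M /d; ring.
rewrite -(pmulr_rgt0 _ e1_gt0) -(pmulr_rgt0 _ m_gt0) {}QE.
have L2 : 0 <= (e1 * e2 - 1) * L ^+ 2 by rewrite mulr_ge0 ?sqr_ge0 // ltW.
have ed : 0 < e1 * d by rewrite mulr_gt0.
have z2 : 0 <= e1 * d * z ^+ 2 by rewrite mulr_ge0 ?sqr_ge0 // ltW.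
rewrite lt_def addr_ge0 ?addr_ge0 ?sqr_ge0 // andbT.
apply: contra nz; rewrite paddr_eq0 ?addr_ge0 ?sqr_ge0 //.
rewrite (paddr_eq0 (sqr_ge0 _) z2) => /and3P[].
rewrite mulf_eq0 (gt_eqF m_gt0) /= sqrf_eq0 => /eqP L0.
rewrite sqrf_eq0 => /eqP M0; rewrite mulf_eq0 (gt_eqF ed) /= sqrf_eq0.
move=> /eqP z0; move: M0; rewrite /M z0 mulr0 addr0 => /eqP.
rewrite mulf_eq0 (gt_eqF m_gt0) /= => /eqP y0.
move: L0; rewrite /L z0 y0 !addr0 => /eqP.
by rewrite mulf_eq0 (gt_eqF e1_gt0) /= => /eqP ->.
Qed.

Section IdealAngles.
Variable R : realType.
Implicit Types p q r x y z t a c : R.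

(* The conditions on the dihedral angles at the edges between ideal vertices: by the
   angle sum at an ideal vertex, [pi - (p + q)] and the like are the angles of the
   truncation triangle, whose sum is less than [pi]. *)
Definition ideal_angles p q r : Prop :=
  [/\ 0 < p, 0 < q & 0 < r] /\
  [/\ p + q < pi, p + r < pi, q + r < pi & pi < p + q + r].

Lemma ideal_angles_convex p q r p' q' r' t : 0 <= t <= 1 ->
  ideal_angles p q r -> ideal_angles p' q' r' ->
  ideal_angles (p + t * (p' - p)) (q + t * (q' - q)) (r + t * (r' - r)).
Proof.
have comb b x y u : 0 <= u <= 1 -> b < x -> b < y -> b < x + u * (y - x).
  move=> /andP[u0 u1] bx b_y; have [xy|yx] := leP x y.
    by apply: (lt_le_trans bx); rewrite lerDl mulr_ge0 // subr_ge0.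
  by apply: (lt_le_trans b_y); nra.
move=> t01 [[p0 q0 r0] [pq pr qr s]] [[p0' q0' r0'] [pq' pr' qr' s']].
split; split; try exact: comb; rewrite -ltrN2.
- by have := @comb (- pi) (- (p + q)) (- (p' + q')) t t01; rewrite !ltrN2; lra.
- by have := @comb (- pi) (- (p + r)) (- (p' + r')) t t01; rewrite !ltrN2; lra.
- by have := @comb (- pi) (- (q + r)) (- (q' + r')) t t01; rewrite !ltrN2; lra.
- by have := @comb pi (p + q + r) (p' + q' + r') t t01; lra.
Qed.

Lemma sin_lt0_2pi x : pi < x -> x < 2 * pi -> sin x < 0.
Proof.
move=> x1 x2; rewrite -(subrK pi x) sinDpi oppr_lt0 sin_gt0_pi //; lra.
Qed.

Lemma cos_lt0_pi x : pi / 2 < x -> x < 3 * pi / 2 -> cos x < 0.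
Proof.
move=> x1 x2; rewrite -(subrK pi x) cosDpi oppr_lt0 cos_gt0_pihalf //; lra.
Qed.

(** Ptolemy's identity: as differences of cosines, the two products on the right telescope to the
    one on the left. *)
Lemma sinMsin_shift x y z :
  sin (x + z) * sin (y + z) = sin x * sin y + sin (x + y + z) * sin z.
Proof. have cz := cos2sin2 z; rewrite !(sinD, cosD); ring: cz. Qed.

Lemma cotB x y : sin x != 0 -> sin (x + y) != 0 ->
  cos (x + y) / sin (x + y) - cos x / sin x = - sin y / (sin (x + y) * sin x).
Proof.
move=> x0 xy0.
have -> : sin y = sin (x + y) * cos x - cos (x + y) * sin x.
  by rewrite -sinB; congr sin; ring.
by field; apply/andP.
Qed.

(** The left side is a difference of two instances of [cotB]; over a common denominator
    [sinMsin_shift] evaluates the numerator. This supplies the diagonal entries of the Jacobian. *)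
Lemma cot_second_difference x y z : sin x != 0 -> sin (x + y) != 0 ->
  sin (x + z) != 0 -> sin (x + y + z) != 0 ->
  cos (x + y + z) / sin (x + y + z) + cos x / sin x
    - cos (x + y) / sin (x + y) - cos (x + z) / sin (x + z)
  = sin y * sin z * sin ((x + y) + (x + z))
    / (sin (x + y + z) * sin x * sin (x + y) * sin (x + z)).
Proof.
move=> x0 xy0 xz0 xyz0.
have E1 := cotB xy0 xyz0; have E2 := cotB x0 xz0.
have E3 : sin (x + y) * sin (x + y + z) - sin (x + z) * sin x
    = sin y * sin (x + y + (x + z)).
  have := sinMsin_shift (x + z) x y.
  rewrite (_ : x + z + y = x + y + z); last by ring.
  by rewrite (_ : x + z + x + y = x + y + (x + z)); [lra | ring].
rewrite [LHS](_ : _ = - sin z / (sin (x + y + z) * sin (x + y))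
  - (- sin z / (sin (x + z) * sin x))); last by rewrite -E1 -E2; ring.
rewrite (mulrAC (sin y)) -E3.
by field; rewrite x0 xy0 xz0 xyz0.
Qed.

Lemma sin_ideal_angles p q r : ideal_angles p q r ->
  [/\ 0 < sin p, 0 < sin q & 0 < sin r] /\
  [/\ 0 < sin (p + q), 0 < sin (p + r), 0 < sin (q + r) & sin (p + q + r) < 0].
Proof.
move=> [[p0 q0 r0] [pq pr qr s]]; split; split; try (apply: sin_gt0_pi; lra).
by apply: sin_lt0_2pi => //; lra.
Qed.

(** The symmetric matrix with diagonal [- sin (v + w) / sin u], [- sin (u + w) / sin v],
    [- sin (u + v) / sin w] and ones elsewhere has determinant [2 - 2 * cos (u + v + w)]; this is
    that fact with denominators cleared. *)
Lemma sin_gram (u v w : R) :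
  sin (v + w) * (sin v * sin w) + sin (u + w) * (sin u * sin w)
  + sin (u + v) * (sin u * sin v)
  + 2 * (sin u * sin v * sin w) * cos (u + v + w)
  = sin (v + w) * sin (u + w) * sin (u + v).
Proof.
have := cos2sin2 u; have := cos2sin2 v; have := cos2sin2 w.
rewrite !(sinD, cosD) => cw cv cu.
ring: cw cv cu.
Qed.

(* After scaling x, y and z, the matrix is all ones off the diagonal, up to the
   factor K below; its determinant is then [4 * sin (p + q + r) ^+ 2]. *)
Lemma hessian_gt0 p q r x y z : ideal_angles p q r ->
  (x, y, z) != (0, 0, 0) ->
  0 < (x + y + z) ^+ 2 * (cos (p + q + r) / sin (p + q + r))
    + x ^+ 2 * (cos p / sin p) + y ^+ 2 * (cos q / sin q)
    + z ^+ 2 * (cos r / sin r)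
    - (x + y) ^+ 2 * (cos (p + q) / sin (p + q))
    - (x + z) ^+ 2 * (cos (p + r) / sin (p + r))
    - (y + z) ^+ 2 * (cos (q + r) / sin (q + r)).
Proof.
move=> D nz; have [[sp sq sr] [spq spr sqr ss]] := sin_ideal_angles D.
case: D => [[p0 q0 r0] [pq pr qr s]].
pose e1 := - sin ((p + q) + (p + r)) / sin (q + r).
pose e2 := - sin ((p + q) + (q + r)) / sin (p + r).
pose e3 := - sin ((p + r) + (q + r)) / sin (p + q).
have e1_gt0 : 0 < e1.
  by rewrite divr_gt0 // oppr_gt0; apply: sin_lt0_2pi; lra.
have [spn sqn srn] : [/\ sin p != 0, sin q != 0 & sin r != 0].
  by split; rewrite gt_eqF.
have [n1 n2 n3 n4] : [/\ sin (p + q) != 0, sin (p + r) != 0,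
    sin (q + r) != 0 & sin (p + q + r) != 0].
  by split; rewrite ?(gt_eqF spq, gt_eqF spr, gt_eqF sqr) // lt_eqF.
have SE : (q + r) + (p + r) + (p + q) = (p + q + r) *+ 2 by rewrite mulr2n; ring.
have cs : cos (p + q + r) < 0 by apply: cos_lt0_pi; lra.
(* By Ptolemy's identity [e1 * e2 - 1] is a positive multiple of the sine of twice [p + q + r],
   which is positive because the sine and the cosine of [p + q + r] are both negative. *)
have m_gt1 : 1 < e1 * e2.
  have -> : e1 * e2 = 1 + sin ((p + q + r) *+ 2) * sin (p + q)
     / (sin (q + r) * sin (p + r)).
    have := sinMsin_shift (q + r) (p + r) (p + q); rewrite SE => E.
    rewrite /e1 /e2 mulf_div mulrNN mulrC (addrC (p + q) (q + r)).
    rewrite (addrC (p + q) (p + r)) mulrC [X in X / _]mulrC E.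
    by field; apply/andP.
  rewrite ltrDl divr_gt0 ?mulr_gt0 // mulr2n sinD.
  by rewrite addr_gt0 // nmulr_lgt0.
have d_gt0 : 0 < e1 * e2 * e3 - e1 - e2 - e3 + 2.
  have -> : e1 * e2 * e3 - e1 - e2 - e3 + 2 = 4 * sin (p + q + r) ^+ 2.
    have := sin_gram (q + r) (p + r) (p + q); rewrite SE mulr2n cosD => E.
    have := cos2Dsin2 (p + q + r) => E1.
    rewrite /e1 /e2 /e3 (addrC (p + q) (q + r)) (addrC (p + q) (p + r)).
    rewrite (addrC (p + r) (q + r)).
    apply: (mulIf n1); apply: (mulIf n2); apply: (mulIf n3).
    move: n1 n2 n3 E E1; set s1 := sin (q + r); set s2 := sin (p + r).
    set s3 := sin (p + q); set s23 := sin (p + r + (p + q)).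
    set s13 := sin (q + r + (p + q)); set s12 := sin (q + r + (p + r)).
    set C := cos (p + q + r); set S := sin (p + q + r) => n1 n2 n3 E E1.
    transitivity (- (s23 * s13 * s12) + s23 * (s2 * s3) + s13 * (s1 * s3)
      + s12 * (s1 * s2) + 2 * (s1 * s2 * s3)).
      by field; rewrite ?n1 ?n2 ?n3.
    rewrite -E -(addrK (C ^+ 2) (S ^+ 2)) (addrC (S ^+ 2)) E1.
    have -> : S * S = 1 - C ^+ 2 by rewrite -E1; ring.
    by ring.
  by rewrite mulr_gt0 ?ltr0n // exprn_even_gt0.
(* The scaling turns each mixed coefficient, such as [- sin r / (sin (p + q + r) * sin (p + q))] for
   [2 * x * y], into the same factor K. *)
pose X := x * sin (q + r) / sin p.
pose Y := y * sin (p + r) / sin q.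
pose Z := z * sin (p + q) / sin r.
have nz' : (X, Y, Z) != (0, 0, 0).
  apply: contra nz => /eqP[X0 Y0 Z0].
  have -> : x = X * sin p / sin (q + r) by rewrite /X; field; apply/andP.
  have -> : y = Y * sin q / sin (p + r) by rewrite /Y; field; apply/andP.
  have -> : z = Z * sin r / sin (p + q) by rewrite /Z; field; apply/andP.
  by rewrite X0 Y0 Z0 !mul0r.
have K_gt0 : 0 < - sin p * sin q * sin r /
    (sin (p + q + r) * sin (p + q) * sin (p + r) * sin (q + r)).
  by rewrite -mulrNN -invrN -!mulNr opprK divr_gt0 ?mulr_gt0 // oppr_gt0.
have := mulr_gt0 K_gt0 (quadratic_form_gt0 e1_gt0 m_gt1 d_gt0 nz').
have Mpq := cotB n1 n4.
have Mpr : cos (p + q + r) / sin (p + q + r) - cos (p + r) / sin (p + r)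
   = - sin q / (sin (p + q + r) * sin (p + r)).
  by rewrite [p + q + r]addrAC cotB // addrAC.
have Mqr : cos (p + q + r) / sin (p + q + r) - cos (q + r) / sin (q + r)
   = - sin p / (sin (p + q + r) * sin (q + r)).
  by have rot : p + q + r = q + r + p by [ring]; rewrite rot cotB // -rot.
have Dp := cot_second_difference spn n1 n2 n4.
have Dq : cos (p + q + r) / sin (p + q + r) + cos q / sin q
    - cos (p + q) / sin (p + q) - cos (q + r) / sin (q + r)
  = sin p * sin r * sin ((p + q) + (q + r))
    / (sin (p + q + r) * sin q * sin (p + q) * sin (q + r)).
  have := @cot_second_difference q p r; rewrite (addrC q p); exact.
have Dr : cos (p + q + r) / sin (p + q + r) + cos r / sin r
    - cos (p + r) / sin (p + r) - cos (q + r) / sin (q + r)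
  = sin p * sin q * sin ((p + r) + (q + r))
    / (sin (p + q + r) * sin r * sin (p + r) * sin (q + r)).
  have := @cot_second_difference r p q.
  rewrite (_ : r + p + q = p + q + r); last by ring.
  rewrite (addrC r p) (addrC r q); exact.
congr (0 < _).
set H := RHS.
rewrite [H](_ : _ = x ^+ 2 * (cos (p + q + r) / sin (p + q + r) + cos p / sin p
    - cos (p + q) / sin (p + q) - cos (p + r) / sin (p + r))
  + y ^+ 2 * (cos (p + q + r) / sin (p + q + r) + cos q / sin q
    - cos (p + q) / sin (p + q) - cos (q + r) / sin (q + r))
  + z ^+ 2 * (cos (p + q + r) / sin (p + q + r) + cos r / sin r
    - cos (p + r) / sin (p + r) - cos (q + r) / sin (q + r))
  + 2 * x * y * (cos (p + q + r) / sin (p + q + r) - cos (p + q) / sin (p + q))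
  + 2 * x * z * (cos (p + q + r) / sin (p + q + r) - cos (p + r) / sin (p + r))
  + 2 * y * z * (cos (p + q + r) / sin (p + q + r) - cos (q + r) / sin (q + r)));
  last by rewrite /H; ring.
rewrite Dp Dq Dr Mpq Mpr Mqr /X /Y /Z /e1 /e2 /e3.
by field; rewrite spn sqn srn n1 n2 n3 n4.
Qed.

(** The logarithm of the formula for [x / 2]: the length of the edge with angle [p] once the
    horospheres touch the truncating plane. It is symmetric in [q] and [r]. *)
Definition log_ratio p q r : R :=
  ln (- sin (p + q + r)) + ln (sin p) - ln (sin (p + q)) - ln (sin (p + r)).

Lemma is_derive_ln_sin a c t : 0 < sin (a + t * c) ->
  is_derive t 1 (fun s => c * ln (sin (a + s * c)))
    (c ^+ 2 * (cos (a + t * c) / sin (a + t * c))).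
Proof.
move=> s0.
have da : is_derive t 1 (fun s : R => a + s * c) c.
  by apply: is_derive_eq; rewrite scaler0 !add0r mul1r /GRing.scale /= mulr1.
have ds : is_derive t 1 (sin \o (fun s : R => a + s * c)) (cos (a + t * c) * c).
  exact: is_derive1_comp.
have dl : is_derive t 1 (@ln R \o (sin \o (fun s : R => a + s * c)))
    ((sin (a + t * c))^-1 * (cos (a + t * c) * c)).
  by apply: is_derive1_comp; exact: is_derive1_ln.
rewrite (_ : (fun s => _) = c *: (@ln R \o (sin \o (fun s : R => a + s * c)))) //.
by apply: is_derive_eq; rewrite /GRing.scale /=; ring.
Qed.

(** The mean value theorem on the segment between the two triples, along which the three lengths are
    paired with the fixed direction [(x, y, z)]; the derivative is the form of [hessian_gt0]. *)
Lemma log_ratio_monotone p q r p' q' r' :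
  ideal_angles p q r -> ideal_angles p' q' r' -> (p, q, r) != (p', q', r') ->
  0 < (log_ratio p' q' r' - log_ratio p q r) * (p' - p)
    + (log_ratio q' p' r' - log_ratio q p r) * (q' - q)
    + (log_ratio r' p' q' - log_ratio r p q) * (r' - r).
Proof.
move=> D D' neq; set x := p' - p; set y := q' - q; set z := r' - r.
have nz : (x, y, z) != (0, 0, 0).
  apply: contra neq => /eqP[/eqP + /eqP + /eqP]; rewrite !subr_eq0.
  by move=> /eqP-> /eqP-> /eqP->.
pose f a c (s : R) := c * ln (sin (a + s * c)).
pose df a c s : R := c ^+ 2 * (cos (a + s * c) / sin (a + s * c)).
(* Adding [pi] turns [- sin (p + q + r)] into a sine, so that all seven terms have the same
   shape. *)
pose g := f (p + q + r + pi) (x + y + z) + f p x + f q y + f r z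
  - f (p + q) (x + y) - f (p + r) (x + z) - f (q + r) (y + z).
pose dg s := df (p + q + r + pi) (x + y + z) s + df p x s + df q y s + df r z s
  - df (p + q) (x + y) s - df (p + r) (x + z) s - df (q + r) (y + z) s.
have Dt (s : R) : 0 <= s <= 1 -> ideal_angles (p + s * x) (q + s * y) (r + s * z).
  by move=> s01; exact: ideal_angles_convex.
have split2 (a b s u v : R) : a + b + s * (u + v) = (a + s * u) + (b + s * v).
  by ring.
have split3 (s : R) : p + q + r + pi + s * (x + y + z)
    = (p + s * x) + (q + s * y) + (r + s * z) + pi by ring.
have dgP (s : R) : 0 <= s <= 1 -> is_derive s 1 g (dg s).
  move=> /Dt /sin_ideal_angles[[? ? ?] [? ? ? ?]].
  have ? : is_derive s 1 (f (p + q + r + pi) (x + y + z)) (df (p + q + r + pi) (x + y + z) s).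
    by apply: is_derive_ln_sin; rewrite split3 sinDpi oppr_gt0.
  have ? : is_derive s 1 (f p x) (df p x s) by exact: is_derive_ln_sin.
  have ? : is_derive s 1 (f q y) (df q y s) by exact: is_derive_ln_sin.
  have ? : is_derive s 1 (f r z) (df r z s) by exact: is_derive_ln_sin.
  have ? : is_derive s 1 (f (p + q) (x + y)) (df (p + q) (x + y) s).
    by apply: is_derive_ln_sin; rewrite split2.
  have ? : is_derive s 1 (f (p + r) (x + z)) (df (p + r) (x + z) s).
    by apply: is_derive_ln_sin; rewrite split2.
  have ? : is_derive s 1 (f (q + r) (y + z)) (df (q + r) (y + z) s).
    by apply: is_derive_ln_sin; rewrite split2.
  by rewrite /g /dg; apply: is_derive_eq.
have dg_gt0 (s : R) : 0 <= s <= 1 -> 0 < dg s.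
  move=> s01; have := hessian_gt0 (Dt _ s01) nz.
  by rewrite /dg /df split3 !split2 cosDpi sinDpi invrN mulrNN.
have [|||s + E] := @MVT R g dg 0 1.
- exact: ltr01.
- by move=> s; rewrite in_itv /= => /andP[s0 s1]; apply: dgP; rewrite !ltW.
- apply: derivable_within_continuous => s; rewrite in_itv /= => s01.
  by have := dgP s s01.
rewrite in_itv /= => /andP[s0 s1].
have : 0 < g 1 - g 0 by rewrite E subr0 mulr1 dg_gt0 // !ltW.
congr (0 < _).
(* Regrouped by [x], [y] and [z], the seven logarithms form the three lengths. *)
have gE (s' : R) (u := p + s' * x) (v := q + s' * y) (w := r + s' * z) :
    g s' = log_ratio u v w * x + log_ratio v u w * y + log_ratio w u v * z.
  rewrite /g /f /log_ratio.
  transitivity ((x + y + z) * ln (sin (p + q + r + pi + s' * (x + y + z)))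
    + x * ln (sin (p + s' * x)) + y * ln (sin (q + s' * y))
    + z * ln (sin (r + s' * z)) - (x + y) * ln (sin (p + q + s' * (x + y)))
    - (x + z) * ln (sin (p + r + s' * (x + z)))
    - (y + z) * ln (sin (q + r + s' * (y + z)))) => //.
  rewrite split3 !split2 -/u -/v -/w sinDpi.
  rewrite (addrC v u) (addrC w u) (addrC w v) [u + w + v]addrAC.
  by rewrite /x /y /z; ring.
rewrite !gE !mul1r !mul0r !addr0.
have -> : p + x = p' by rewrite addrC subrK.
have -> : q + y = q' by rewrite addrC subrK.
have -> : r + z = r' by rewrite addrC subrK.
by ring.
Qed.

End IdealAngles.

(** * Angles in terms of lengths *)

Section AnglesOfLengths.
Variable R : realType.
Implicit Types x y z n w d : R.

(** A right triangle with signed leg [n], other leg [Num.sqrt d] and hypotenuse [Num.sqrt w];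
    positivity of [d] keeps the quotient strictly between -1 and 1. *)
Lemma acos_sqrt n w d : 0 < d -> n ^+ 2 + d = w ->
  [/\ 0 < acos (n / Num.sqrt w) < pi,
      cos (acos (n / Num.sqrt w)) = n / Num.sqrt w &
      sin (acos (n / Num.sqrt w)) = Num.sqrt d / Num.sqrt w].
Proof.
move=> d0 wE; have w0 : 0 < w by rewrite -wE; have := sqr_ge0 n; lra.
have sw0 : 0 < Num.sqrt w by rewrite sqrtr_gt0.
set t := n / Num.sqrt w.
have t2 : t ^+ 2 = n ^+ 2 / w by rewrite /t expr_div_n sqr_sqrtr // ltW.
have t2_lt1 : t ^+ 2 < 1 by rewrite t2 ltr_pdivrMr // mul1r -wE ltrDl.
have t11 : -1 < t < 1 by rewrite -ltr_norml -(expr_lt1 (n := 2)) // real_normK ?num_real.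
have t11' : -1 <= t <= 1 by case/andP: t11 => ? ?; rewrite !ltW.
have [/andP[a0 api] ca] := acos_def t11'.
have sa : sin (acos t) = Num.sqrt d / Num.sqrt w.
  rewrite sin_acos // t2 -sqrtrV ?(ltW w0) // -sqrtrM ?(ltW d0) //.
  by congr Num.sqrt; rewrite -wE; field; rewrite wE gt_eqF.
split => //; rewrite !lt_def a0 api !andbT.
apply/andP; split; apply/eqP => E; move: sa.
  by rewrite E sin0 => /esym/eqP; rewrite gt_eqF // divr_gt0 ?sqrtr_gt0.
by rewrite -E sinpi => /esym/eqP; rewrite gt_eqF // divr_gt0 ?sqrtr_gt0.
Qed.

(* Up to a positive factor, minus the Gram determinant of the lifts of the vertices
   to Minkowski space. *)
Definition gram13 x y z : R :=
  2 * x * y * z + 2 * x * y + 2 * y * z + 2 * x * z - x ^+ 2 - y ^+ 2 - z ^+ 2.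

(** The dihedral angle at an edge between ideal vertices; [x] belongs to the side of the truncation
    triangle on the face spanned by this edge and the hyperideal vertex. *)
Definition ideal_angle x y z : R :=
  acos ((y + z - x) / Num.sqrt (2 * y * z * (x + 2))).

(* The hyperbolic law of cosines in the truncation triangle, whose sides have
   hyperbolic cosines [1 + x], [1 + y] and [1 + z]. *)
Definition hyper_angle x y z : R :=
  acos ((y + z + y * z - x)
    / Num.sqrt ((2 * y + y ^+ 2) * (2 * z + z ^+ 2))).

Lemma ideal_angleC x y z : ideal_angle x z y = ideal_angle x y z.
Proof. by rewrite /ideal_angle (addrC z) (mulrAC 2 z). Qed.

Lemma sqrtrM3 a b c e : 0 < a -> 0 < b -> 0 < c -> 0 < e ->
  Num.sqrt (a * b * c * e)
  = Num.sqrt a * Num.sqrt b * Num.sqrt c * Num.sqrt e :> R.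
Proof. by move=> *; rewrite !sqrtrM ?mulr_ge0 ?ltW. Qed.

Lemma ideal_angleP x y z : 0 < x -> 0 < y -> 0 < z -> 0 < gram13 x y z ->
  let s := Num.sqrt 2 * Num.sqrt y * Num.sqrt z * Num.sqrt (x + 2) in
  [/\ 0 < ideal_angle x y z < pi,
      cos (ideal_angle x y z) = (y + z - x) / s &
      sin (ideal_angle x y z) = Num.sqrt (gram13 x y z) / s].
Proof.
move=> x0 y0 z0 d0 s; rewrite /s -sqrtrM3 ?addr_gt0 ?ltr0n //.
by apply: acos_sqrt => //; rewrite /gram13; ring.
Qed.

Lemma hyper_angleP x y z : 0 < x -> 0 < y -> 0 < z -> 0 < gram13 x y z ->
  let s := Num.sqrt y * Num.sqrt z * Num.sqrt (y + 2) * Num.sqrt (z + 2) in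
  [/\ 0 < hyper_angle x y z < pi,
      cos (hyper_angle x y z) = (y + z + y * z - x) / s &
      sin (hyper_angle x y z) = Num.sqrt (gram13 x y z) / s].
Proof.
move=> x0 y0 z0 d0 s; rewrite /s -sqrtrM3 ?addr_gt0 ?ltr0n //.
rewrite (_ : y * z * (y + 2) * (z + 2) = (2 * y + y ^+ 2) * (2 * z + z ^+ 2)).
  by apply: acos_sqrt => //; rewrite /gram13; ring.
by ring.
Qed.

Lemma gram13C x y z : gram13 y x z = gram13 x y z.
Proof. by rewrite /gram13; ring. Qed.

Lemma gram13CA x y z : gram13 z x y = gram13 x y z.
Proof. by rewrite /gram13; ring. Qed.

(* The three dihedral angles at an ideal vertex add up to pi. *)
Lemma hyper_angleE x y z : 0 < x -> 0 < y -> 0 < z -> 0 < gram13 x y z ->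
  hyper_angle x y z = pi - ideal_angle y x z - ideal_angle z x y.
Proof.
move=> x0 y0 z0 d0.
have [h0 ch sh] := hyper_angleP x0 y0 z0 d0.
have := @ideal_angleP y x z y0 x0 z0; rewrite gram13C => /(_ d0)[a0 ca sa].
have := @ideal_angleP z x y z0 x0 y0; rewrite gram13CA => /(_ d0)[b0 cb sb].
have k2 : Num.sqrt 2 * Num.sqrt 2 = 2 :> R by rewrite -expr2 sqr_sqrtr.
have X2 : Num.sqrt x * Num.sqrt x = x by rewrite -expr2 sqr_sqrtr ?ltW.
have D2 : Num.sqrt (gram13 x y z) ^+ 2 = gram13 x y z by rewrite sqr_sqrtr ?ltW.
move: ch sh ca sa cb sb; set h := hyper_angle _ _ _ in h0 *.
set a := ideal_angle y _ _ in a0 *; set b := ideal_angle z _ _ in b0 *.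
have pos u : 0 < u -> Num.sqrt u != 0 :> R by move=> u0; rewrite gt_eqF // sqrtr_gt0.
have k0 := pos 2 (ltr0n _ 2); have X0 := pos _ x0.
have Y0 := pos _ y0; have Z0 := pos _ z0.
have Y'0 := pos (y + 2) (addr_gt0 y0 (ltr0n _ 2)).
have Z'0 := pos (z + 2) (addr_gt0 z0 (ltr0n _ 2)).
move: k2 X2 D2 k0 X0 Y0 Z0 Y'0 Z'0.
move: (Num.sqrt 2) (Num.sqrt x) (Num.sqrt y) (Num.sqrt z) (Num.sqrt (y + 2))
  (Num.sqrt (z + 2)) (Num.sqrt (gram13 x y z)).
move=> k X Y Z Y' Z' D k2 X2 D2 k0 X0 Y0 Z0 Y'0 Z'0 ch sh ca sa cb sb.
have kX : k * X * (k * X) = 2 * x by rewrite mulrACA k2 X2.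
have x_neq0 : x != 0 by rewrite gt_eqF.
have sab : sin (a + b) = sin h.
  rewrite sinD sa ca sb cb sh.
  rewrite [LHS](_ : _ = 2 * x * D / (k * X * (k * X) * (Y * Z * Y' * Z'))).
    by rewrite kX; field; rewrite x_neq0 Y0 Z0 Y'0 Z'0.
  by field; rewrite X0 k0 Y0 Z0 Y'0 Z'0.
have cab : cos (a + b) = - cos h.
  rewrite cosD sa ca sb cb ch.
  rewrite [LHS](_ : _ = ((x + z - y) * (x + y - z) - D ^+ 2)
      / (k * X * (k * X) * (Y * Z * Y' * Z'))).
    by rewrite kX D2 /gram13; field; rewrite x_neq0 Y0 Z0 Y'0 Z'0.
  by field; rewrite X0 k0 Y0 Z0 Y'0 Z'0.
(* Since [sin h] is positive, [a + b] stays below [pi], where the cosine determines the angle. *)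
have ab : a + b < pi.
  rewrite ltNge; apply/negP => ab.
  have : 0 < sin h by rewrite sin_gt0_pi.
  rewrite -sab -(subrK pi (a + b)) sinDpi oppr_gt0 ltNge sin_ge0_pi //.
  by move: a0 b0; lra.
have abE : a + b = pi - h.
  rewrite -[LHS]cosK; last by rewrite in_itv /=; apply/andP; move: a0 b0; lra.
  rewrite cab -cosN -cosDpi cosK; first by rewrite addrC.
  by rewrite in_itv /=; apply/andP; move: h0; lra.
by rewrite -addrA -opprD abE; ring.
Qed.

(** The angles of the truncation triangle are the supplements of the pairwise sums, which bounds
    these sums by [pi]. In the quotient of sines the Gram determinant cancels and [x / 2] is
    left. *)
Lemma angles_of_lengths x y z :
  0 < x -> 0 < y -> 0 < z -> 0 < gram13 x y z ->
  [/\ ideal_angles (ideal_angle x y z) (ideal_angle y x z) (ideal_angle z x y),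
      hyper_angle x y z = pi - ideal_angle y x z - ideal_angle z x y,
      hyper_angle y x z = pi - ideal_angle x y z - ideal_angle z x y,
      hyper_angle z x y = pi - ideal_angle x y z - ideal_angle y x z &
      ln (x / 2)
        = log_ratio (ideal_angle x y z) (ideal_angle y x z) (ideal_angle z x y)].
Proof.
move=> x0 y0 z0 d0.
have d0y : 0 < gram13 y x z by rewrite gram13C.
have d0z : 0 < gram13 z x y by rewrite gram13CA.
have hx := hyper_angleE x0 y0 z0 d0.
have hy : hyper_angle y x z = pi - ideal_angle x y z - ideal_angle z x y.
  by rewrite hyper_angleE // (ideal_angleC z).
have hz : hyper_angle z x y = pi - ideal_angle x y z - ideal_angle y x z.
  by rewrite hyper_angleE // (ideal_angleC x) (ideal_angleC y).
have [hx0 chx shx] := hyper_angleP x0 y0 z0 d0.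
have [hy0 _ shy] := hyper_angleP y0 x0 z0 d0y.
have [hz0 _ shz] := hyper_angleP z0 x0 y0 d0z.
have [p0 cp sp] := ideal_angleP x0 y0 z0 d0.
have [q0 _ _] := ideal_angleP y0 x0 z0 d0y.
have [r0 _ _] := ideal_angleP z0 x0 y0 d0z.
move: shy shz; rewrite (gram13C x y z) (gram13CA x y z) => shy shz.
have k2 : Num.sqrt 2 ^+ 2 = 2 :> R by rewrite sqr_sqrtr.
have sq u : 0 < u -> Num.sqrt u ^+ 2 = u :> R by move=> ?; rewrite sqr_sqrtr ?ltW.
have X2 := sq _ x0; have Y2 := sq _ y0; have Z2 := sq _ z0.
have pos u : 0 < u -> 0 < Num.sqrt u :> R by move=> u0; rewrite sqrtr_gt0.
have D0 := pos _ d0.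
have k0 := pos 2 (ltr0n _ 2); have X0 := pos _ x0.
have Y0 := pos _ y0; have Z0 := pos _ z0.
have X'0 := pos (x + 2) (addr_gt0 x0 (ltr0n _ 2)).
have Y'0 := pos (y + 2) (addr_gt0 y0 (ltr0n _ 2)).
have Z'0 := pos (z + 2) (addr_gt0 z0 (ltr0n _ 2)).
set p := ideal_angle x y z in hx hy hz p0 cp sp *.
set q := ideal_angle y x z in hx hy hz q0 *.
set r := ideal_angle z x y in hx hy hz r0 *.
have sqr : sin (q + r) = sin (hyper_angle x y z).
  by rewrite hx -addrA -opprD sinB sinpi cospi mul0r sub0r mulN1r opprK.
have cqr : cos (q + r) = - cos (hyper_angle x y z).
  by rewrite hx -addrA -opprD cosB sinpi cospi mul0r addr0 mulN1r opprK.
have spr : sin (p + r) = sin (hyper_angle y x z).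
  by rewrite hy -addrA -opprD sinB sinpi cospi mul0r sub0r mulN1r opprK.
have spq : sin (p + q) = sin (hyper_angle z x y).
  by rewrite hz -addrA -opprD sinB sinpi cospi mul0r sub0r mulN1r opprK.
move: cp sp shx shy shz chx.
move: k2 X2 Y2 Z2 D0 k0 X0 Y0 Z0 X'0 Y'0 Z'0.
move: (Num.sqrt 2) (Num.sqrt x) (Num.sqrt y) (Num.sqrt z) (Num.sqrt (x + 2))
  (Num.sqrt (y + 2)) (Num.sqrt (z + 2)) (Num.sqrt (gram13 x y z)).
move=> k X Y Z X' Y' Z' D k2 X2 Y2 Z2 D0 k0 X0 Y0 Z0 X'0 Y'0 Z'0 cp sp shx shy shz chx.
have sS : - sin (p + q + r) = D / (k * X' * Y' * Z').
  rewrite -addrA sinD sqr cqr cp sp shx chx -Y2 -Z2.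
  by field; rewrite !gt_eqF.
have sp0 : 0 < sin p by rewrite sin_gt0_pi.
have sS0 : 0 < - sin (p + q + r) by rewrite sS divr_gt0 // !mulr_gt0.
have [sx0 sy0 sz0] : [/\ 0 < sin (q + r), 0 < sin (p + r) & 0 < sin (p + q)].
  by rewrite sqr spr spq !sin_gt0_pi.
split => //.
  move: hx0 hy0 hz0; rewrite hx hy hz => hx0 hy0 hz0.
  split; split; try lra.
  (* A sum of at most [pi] would have nonnegative sine, against [sS0]. *)
  rewrite ltNge; apply/negP => S_le; move: sS0; rewrite oppr_gt0 ltNge.
  by rewrite sin_ge0_pi //; move: p0 q0 r0; lra.
rewrite /log_ratio -lnM ?posrE // -ln_div ?posrE ?mulr_gt0 //.
rewrite -ln_div ?posrE ?divr_gt0 ?mulr_gt0 //.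
congr ln; rewrite sS sp spq spr shy shz -X2 -k2.
by field; rewrite !gt_eqF.
Qed.
End AnglesOfLengths.

(** * The Klein model *)

Section Klein.
Variable R : realType.
Implicit Types (u v w p d : 'rV[R]_3) (s t : R).

Lemma dotC u v : dot u v = dot v u.
Proof. by apply: eq_bigr => k _; rewrite mulrC. Qed.

Lemma dotDl u v w : dot (u + v) w = dot u w + dot v w.
Proof. by rewrite -big_split; apply: eq_bigr => k _; rewrite mxE mulrDl. Qed.

Lemma dotZl t u w : dot (t *: u) w = t * dot u w.
Proof. by rewrite /dot mulr_sumr; apply: eq_bigr => k _; rewrite mxE mulrA. Qed.

Lemma dotNl u w : dot (- u) w = - dot u w.
Proof. by rewrite -scaleN1r dotZl mulN1r. Qed.

Lemma dotDr u v w : dot u (v + w) = dot u v + dot u w.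
Proof. by rewrite !(dotC u) dotDl. Qed.

Lemma dotZr t u w : dot u (t *: w) = t * dot u w.
Proof. by rewrite !(dotC u) dotZl. Qed.

Lemma dotNr u w : dot u (- w) = - dot u w.
Proof. by rewrite !(dotC u) dotNl. Qed.

Definition dot_lin := (dotDl, dotDr, dotNl, dotNr, dotZl, dotZr).

Lemma dot_ge0 u : 0 <= dot u u.
Proof. by apply: sumr_ge0 => k _; rewrite -expr2 sqr_ge0. Qed.

Lemma dot_gt0 u : u != 0 -> 0 < dot u u.
Proof.
move=> u0; rewrite lt_def dot_ge0 andbT; apply: contra u0 => /eqP uu0.
apply/eqP/rowP => k; rewrite mxE; apply/eqP; rewrite -sqrf_eq0 expr2.
have /psumr_eq0P -> // : \sum_(k < 3) u 0 k * u 0 k = 0 by [].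
by move=> i _; rewrite -expr2 sqr_ge0.
Qed.

Lemma hdistC u v : hdist u v = hdist v u.
Proof. by rewrite /hdist dotC (mulrC (1 - dot u u)). Qed.

Lemma segmentC u v : segment u v = segment v u.
Proof.
apply/seteqP; split => _ [t /andP[t0 t1] ->]; exists (1 - t);
  by rewrite ?subr_ge0 ?t1 ?gerBl ?t0 // subKr addrC.
Qed.

(** The argument is the hyperbolic cosine of [ln t], and its square minus 1 is the square of
    [(t - t^-1) / 2]. *)
Lemma arcosh_half_sum t : 0 < t -> arcosh ((t + t^-1) / 2) = `|ln t|.
Proof.
move=> t0; have tn0 : t != 0 by rewrite gt_eqF.
have -> : arcosh ((t + t^-1) / 2) = ln ((t + t^-1) / 2 + `|(t - t^-1) / 2|).
  by rewrite /arcosh -sqrtr_sqr; congr (ln (_ + Num.sqrt _)); field.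
have [t1|/ltW t1] := leP 1 t.
  have ti1 : t^-1 <= 1 by rewrite invf_le1.
  rewrite !ger0_norm ?ln_ge0 //; last by rewrite divr_ge0 // subr_ge0 (le_trans ti1).
  by congr ln; field.
have ti1 : 1 <= t^-1 by rewrite invf_ge1.
rewrite !ler0_norm ?ln_le0 //; last by rewrite pmulr_lle0 // subr_le0 (le_trans t1).
by rewrite -lnV ?posrE //; congr ln; field.
Qed.

(* Reversed Cauchy-Schwarz in Minkowski space, for the timelike vector (w, 1) and
   the lightlike vectors (u, 1) and (v, 1). *)
Lemma horosphere_product u v w : dot u u = 1 -> dot v v = 1 -> dot u v < 1 ->
  (1 - dot w w) * (1 - dot u v) <= 2 * (1 - dot w u) * (1 - dot w v).
Proof.
move=> u1 v1 uv; have g0 : 0 < 1 - dot u v by rewrite subr_gt0.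
set g := 1 - dot u v in g0 *; pose s := (1 - dot w u) / g.
(* The lift of [w] minus [s] times that of [v] is orthogonal to the lift of [u]. Adding a multiple
   of the latter, which is null, keeps the Minkowski square and can make the last coordinate vanish,
   so that this square becomes Euclidean. *)
have := dot_ge0 (w - u + s *: (u - v)).
rewrite !dot_lin u1 v1 (dotC u w) (dotC v w) (dotC v u).
have -> : dot u v = 1 - g by rewrite /g; ring.
have sE : 1 - dot w u = s * g by rewrite /s divfK // gt_eqF.
have -> : dot w u = 1 - s * g by rewrite -sE; ring.
move=> /(mulr_ge0 (ltW g0)); lra.
Qed.

(* Gram matrix form of the inner product of the projections of [(w, 1)] and
   [(w', 1)] to the Minkowski orthogonal of [(u, 1)] and [(v, 1)]. *)
Definition edge_form u v w w' : R :=
  let a := dot u u - 1 in let b := dot u v - 1 in let c := dot v v - 1 in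
  dot w w' - 1 - (c * (dot w u - 1) * (dot w' u - 1)
    - b * ((dot w u - 1) * (dot w' v - 1) + (dot w v - 1) * (dot w' u - 1))
    + a * (dot w v - 1) * (dot w' v - 1)) / (a * c - b ^+ 2).

Lemma edge_formCr u v w w' : edge_form u v w' w = edge_form u v w w'.
Proof. by rewrite /edge_form (dotC w' w); congr (_ - _ / _); ring. Qed.

Lemma kmetric_orth_comp p d u v : kmetric p d d != 0 ->
  kmetric p (orth_comp p d u) (orth_comp p d v)
  = kmetric p u v - kmetric p u d * kmetric p v d / kmetric p d d.
Proof.
move=> d0; have lin s t : kmetric p (u - s *: d) (v - t *: d)
    = kmetric p u v - t * kmetric p u d - s * kmetric p v d + s * t * kmetric p d d.
  by rewrite /kmetric !dot_lin (dotC d v); ring.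
by rewrite /orth_comp lin; field.
Qed.

(** Orthogonally to an edge, the metric at [p] is the Minkowski form on the complement of the plane
    spanned by the lifts of [u] and [v], up to a factor. Only this factor depends on [p], so it
    cancels in angles. The negative determinant says that the plane has signature (1,1). *)
Lemma kmetric_orth_edge u v w w' t (p := (1 - t) *: u + t *: v) :
  dot p p < 1 -> (dot u u - 1) * (dot v v - 1) - (dot u v - 1) ^+ 2 < 0 ->
  kmetric p (orth_comp p (v - u) (w - p)) (orth_comp p (v - u) (w' - p))
  = edge_form u v w w' / (1 - dot p p).
Proof.
move=> p1 det0.
have N0 : 1 - dot p p != 0 by rewrite gt_eqF // subr_gt0.
have D0 : (dot u v - 1) ^+ 2 - (dot u u - 1) * (dot v v - 1) != 0.
  by rewrite gt_eqF //; lra.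
have ddE : kmetric p (v - u) (v - u) = ((dot u v - 1) ^+ 2
     - (dot u u - 1) * (dot v v - 1)) / (1 - dot p p) ^+ 2.
  rewrite /kmetric; apply: (mulIf (expf_neq0 2 N0)).
  rewrite divfK ?expf_neq0 // mulrDl divfK ?expf_neq0 //.
  rewrite expr2 mulrA divfK //.
  by rewrite /p !dot_lin (dotC v u); ring.
rewrite kmetric_orth_comp ddE; last by rewrite mulf_neq0 // invr_neq0 // expf_neq0.
move: N0; rewrite /edge_form /kmetric /p !dot_lin (dotC v u) (dotC u w) (dotC v w).
rewrite (dotC u w') (dotC v w') in D0 *.
move: D0; move: (dot u u) (dot u v) (dot v v) (dot w u) (dot w v) (dot w' u)
  (dot w' v) (dot w w') => a b c wu wv w'u w'v ww' D0 N0.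
by field; do ?(apply/andP; split) => //; rewrite -oppr_eq0 opprB.
Qed.

Lemma kangle_orth_edge u v w w' t (p := (1 - t) *: u + t *: v) :
  dot p p < 1 -> (dot u u - 1) * (dot v v - 1) - (dot u v - 1) ^+ 2 < 0 ->
  0 <= edge_form u v w w -> 0 <= edge_form u v w' w' ->
  kangle p (orth_comp p (v - u) (w - p)) (orth_comp p (v - u) (w' - p))
  = acos (edge_form u v w w'
      / Num.sqrt (edge_form u v w w * edge_form u v w' w')).
Proof.
move=> p1 det0 ww w'w'; have N0 : 0 < 1 - dot p p by rewrite subr_gt0.
rewrite /kangle !kmetric_orth_edge //; congr acos.
rewrite -sqrtrM ?divr_ge0 ?(ltW N0) // mulf_div sqrtrM ?mulr_ge0 //.
rewrite -expr2 sqrtrV ?exprn_ge0 ?(ltW N0) // sqrtr_sqr gtr0_norm //.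
by rewrite invfM invrK mulrACA mulVf ?mulr1 ?gt_eqF.
Qed.

End Klein.

(** * Lengths of the edges of a tetrahedron *)

Section Tetrahedron.
Variables (R : realType) (h : 'I_4) (P : decorated_tetrahedron R h).
Implicit Types (i j k l : 'I_4) (s t : R).

Local Notation v := (vtx P).
Local Notation sz := (hsize P).

(** Minus the Minkowski product of the lifts [(v i, 1)] and [(v j, 1)]; [kappa] is the Minkowski
    square of the lift of the hyperideal vertex. *)
Definition gap i j : R := 1 - dot (v i) (v j).
Definition kappa : R := dot (v h) (v h) - 1.

Lemma dot_gap i j : dot (v i) (v j) = 1 - gap i j.
Proof. by rewrite subKr. Qed.

Lemma dot_kappa : dot (v h) (v h) = 1 + kappa.
Proof. by rewrite addrC subrK. Qed.

Lemma gapC i j : gap i j = gap j i.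
Proof. by rewrite /gap dotC. Qed.

Lemma kappa_gt0 : 0 < kappa.
Proof. by rewrite subr_gt0 vtx_hyperideal. Qed.

Lemma one_sub_norm_ideal i j t (x := (1 - t) *: v i + t *: v j) :
  i != h -> j != h -> 1 - dot x x = 2 * t * (1 - t) * gap i j.
Proof.
move=> ih jh; rewrite /x !dot_lin !vtx_ideal // (dotC (v j)) dot_gap; ring.
Qed.

Lemma one_sub_norm_hyper i t (x := (1 - t) *: v i + t *: v h) :
  i != h -> 1 - dot x x = 2 * t * (1 - t) * gap h i - t ^+ 2 * kappa.
Proof.
move=> ih; rewrite /x !dot_lin dot_kappa vtx_ideal // (dotC (v i)) dot_gap; ring.
Qed.

Lemma gap_ideal_gt0 i j : i != h -> j != h -> i != j -> 0 < gap i j.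
Proof.
move=> ih jh ij; have [_ [[t /andP[t0 t1] ->]]] := vtx_edges_meet_H3 P ij.
rewrite /H3 /= -subr_gt0 one_sub_norm_ideal //.
case: (ltP 0 (gap i j)) => // g0; rewrite ltNge => /negP[].
by rewrite mulr_ge0_le0 // !mulr_ge0 // subr_ge0.
Qed.

(** At a point of the edge inside the ball, [2 * t * (1 - t) * gap h i] exceeds the nonnegative
    [t ^+ 2 * kappa]. *)
Lemma gap_hyper_gt0 i : i != h -> 0 < gap h i.
Proof.
move=> ih; have [_ [[t /andP[t0 t1] ->]]] := vtx_edges_meet_H3 P ih.
rewrite /H3 /= -subr_gt0 one_sub_norm_hyper //.
case: (ltP 0 (gap h i)) => // g0; rewrite ltNge => /negP[].
rewrite subr_le0 (@le_trans _ _ 0) //.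
  by rewrite mulr_ge0_le0 // !mulr_ge0 // subr_ge0.
by rewrite mulr_ge0 ?sqr_ge0 // ltW // kappa_gt0.
Qed.

Lemma vtx_free (c : 'I_4 -> R) :
  \sum_i c i = 0 -> \sum_i c i *: v i = 0 -> forall i, c i = 0.
Proof.
move=> c0 cv0 i; have /row_freeP[B AB] := vtx_affinely_independent P.
set A := (X in X *m B) in AB.
pose r := \row_j c j.
have rA : r *m A = 0.
  apply/rowP => k; rewrite [LHS]mxE [RHS]mxE.
  have [[k' kE]|[k' kE]] : (exists k' : 'I_3, k = lshift 1 k')
      \/ (exists k' : 'I_1, k = rshift 3 k').
    by case: (@split_ordP 3 1 k) => k' ->; [left|right]; exists k'.
    transitivity (\sum_j c j * v j 0 k').
      by apply: eq_bigr => j _; rewrite mxE mxE kE row_mxEl.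
    have /rowP/(_ k') := cv0; rewrite summxE mxE => E; rewrite -[RHS]E.
    by apply: eq_bigr => j _; rewrite mxE.
  rewrite -[RHS]c0; apply: eq_bigr => j _.
  by rewrite mxE mxE kE row_mxEr mxE (ord1 k') eqxx mulr1.
have : r *m A *m B = 0 by rewrite rA mul0mx.
by rewrite -mulmxA AB mulmx1 => /rowP/(_ i); rewrite !mxE.
Qed.

Lemma sqrtr_eq (a b : R) : 0 <= b -> b ^+ 2 = a -> Num.sqrt a = b.
Proof. by move=> b0 <-; rewrite sqrtr_sqr ger0_norm. Qed.

(** Squared and divided by [t * gap i j], the horosphere equation becomes linear:
    [t * gap i j = 2 * sz i ^+ 2 * (1 - t)]. *)
Lemma footE_ideal i j : i != h -> j != h -> i != j ->
  let t := 2 * sz i ^+ 2 / (gap i j + 2 * sz i ^+ 2) in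
  foot P i j = (1 - t) *: v i + t *: v j.
Proof.
move=> ih jh ij t; have g0 := gap_ideal_gt0 ih jh ij; have s0 := hsize_gt0 P ih.
have den0 : 0 < gap i j + 2 * sz i ^+ 2 by rewrite addr_gt0 // mulr_gt0 // exprn_gt0.
have t0 : 0 < t by rewrite divr_gt0 // mulr_gt0 // exprn_gt0.
have tE : t * (gap i j + 2 * sz i ^+ 2) = 2 * sz i ^+ 2 by rewrite divfK // gt_eqF.
clearbody t.
have tg : 2 * sz i ^+ 2 * (1 - t) = t * gap i j by move: tE; lra.
have t1 : 0 < 1 - t.
  by rewrite -(pmulr_rgt0 _ (_ : 0 < 2 * sz i ^+ 2)) ?tg mulr_gt0 // exprn_gt0.
have N0 : 0 < 2 * t * (1 - t) * gap i j by rewrite !mulr_gt0.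
have hor (u : R) : 1 - dot ((1 - u) *: v i + u *: v j) (v i) = u * gap i j.
  by rewrite !dot_lin vtx_ideal // dotC dot_gap; ring.
rewrite /foot /end_surface (negbTE ih); apply: xget_unique.
  split; first split.
  - by exists t => //; move: t0 t1; lra.
  - by rewrite /H3 /= -subr_gt0 one_sub_norm_ideal.
  split; first by rewrite /H3 /= -subr_gt0 one_sub_norm_ideal.
  rewrite hor one_sub_norm_ideal // (@sqrtr_eq _ (t * gap i j / sz i)).
  - by field; rewrite gt_eqF.
  - by rewrite divr_ge0 ?mulr_ge0 ?ltW.
  - apply: (mulIf (lt0r_neq0 (exprn_gt0 2 s0))); rewrite expr_div_n divfK ?expf_neq0 ?gt_eqF //.
    by rewrite expr2 -{2}tg; ring.
move=> _ [[[u /andP[u0 u1] ->]]]; rewrite /H3 /= -subr_gt0 one_sub_norm_ideal //.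
move=> M0 [_]; rewrite hor one_sub_norm_ideal // => E.
suff -> : u = t by [].
(* The end [v i], at [u = 0], is on the sphere and not in [H3], so [u] may be cancelled. *)
have u_gt0 : 0 < u.
  by rewrite lt_def u0 andbT; apply/eqP => u00; move: M0; rewrite u00 mulr0 !mul0r ltxx.
have : u * (u * gap i j ^+ 2) = u * (sz i ^+ 2 * (2 * (1 - u) * gap i j)).
  rewrite [LHS](_ : _ = (u * gap i j) ^+ 2); last by ring.
  by rewrite E exprMn sqr_sqrtr ?ltW //; ring.
move/(mulfI (lt0r_neq0 u_gt0)) => {}E.
apply: (mulIf (lt0r_neq0 den0)); rewrite tE.
apply: (mulIf (lt0r_neq0 g0)); move: E; lra.
Qed.

(** Squaring the horosphere equation and dividing by [t] again leaves a linear equation, now with a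
    term in [kappa]. *)
Lemma footE_ideal_hyper i : i != h ->
  let t := 2 * sz i ^+ 2 * gap h i
    / (gap h i ^+ 2 + 2 * sz i ^+ 2 * gap h i + sz i ^+ 2 * kappa) in
  foot P i h = (1 - t) *: v i + t *: v h.
Proof.
move=> ih t; have g0 := gap_hyper_gt0 ih; have s0 := hsize_gt0 P ih.
have k0 := kappa_gt0.
pose den := gap h i ^+ 2 + 2 * sz i ^+ 2 * gap h i + sz i ^+ 2 * kappa.
have den0 : 0 < den by rewrite !addr_gt0 ?mulr_gt0 ?exprn_gt0.
have t0 : 0 < t by rewrite divr_gt0 // !mulr_gt0 // exprn_gt0.
have tE : t * den = 2 * sz i ^+ 2 * gap h i by rewrite divfK // gt_eqF.
clearbody t.
have tg : sz i ^+ 2 * (2 * (1 - t) * gap h i - t * kappa) = t * gap h i ^+ 2.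
  by move: tE; rewrite /den; lra.
have N0 : 0 < 2 * (1 - t) * gap h i - t * kappa.
  by rewrite -(pmulr_rgt0 _ (exprn_gt0 2 s0)) tg mulr_gt0 // exprn_gt0.
have t1 : 0 < 1 - t.
  by rewrite -(pmulr_lgt0 _ g0); have := mulr_gt0 t0 k0; move: N0; lra.
have N0' : 0 < 2 * t * (1 - t) * gap h i - t ^+ 2 * kappa.
  by have := mulr_gt0 t0 N0; lra.
have hor (u : R) : 1 - dot ((1 - u) *: v i + u *: v h) (v i) = u * gap h i.
  by rewrite !dot_lin vtx_ideal // dot_gap; ring.
rewrite /foot /end_surface (negbTE ih); apply: xget_unique.
  split; first split.
  - by exists t => //; move: t0 t1; lra.
  - by rewrite /H3 /= -subr_gt0 one_sub_norm_hyper.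
  split; first by rewrite /H3 /= -subr_gt0 one_sub_norm_hyper.
  rewrite hor one_sub_norm_hyper // (@sqrtr_eq _ (t * gap h i / sz i)).
  - by field; rewrite gt_eqF.
  - by rewrite divr_ge0 ?mulr_ge0 ?ltW.
  - apply: (mulIf (lt0r_neq0 (exprn_gt0 2 s0))); rewrite expr_div_n divfK ?expf_neq0 ?gt_eqF //.
    by transitivity (t * (t * gap h i ^+ 2)); [ring | rewrite -tg; ring].
move=> _ [[[u /andP[u0 u1] ->]]]; rewrite /H3 /= -subr_gt0 one_sub_norm_hyper //.
move=> M0 [_]; rewrite hor one_sub_norm_hyper // => E.
suff -> : u = t by [].
have u_gt0 : 0 < u.
  rewrite lt_def u0 andbT; apply/eqP => u00; move: M0.
  by rewrite u00 mulr0 expr0n /= !mul0r subrr ltxx.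
have : u * (u * gap h i ^+ 2)
    = u * (sz i ^+ 2 * (2 * (1 - u) * gap h i - u * kappa)).
  rewrite [LHS](_ : _ = (u * gap h i) ^+ 2); last by ring.
  by rewrite E exprMn sqr_sqrtr ?ltW //; ring.
move/(mulfI (lt0r_neq0 u_gt0)) => {}E.
by apply: (mulIf (lt0r_neq0 den0)); rewrite tE /den; move: E; lra.
Qed.

(** The polar plane of [v h] cuts the edge where [(1 - t) * kappa = t * gap h i]. *)
Lemma footE_hyper i : i != h ->
  let t := kappa / (kappa + gap h i) in foot P h i = (1 - t) *: v h + t *: v i.
Proof.
move=> ih t; have g0 := gap_hyper_gt0 ih; have k0 := kappa_gt0.
have den0 : 0 < kappa + gap h i by rewrite addr_gt0.
have t0 : 0 < t by rewrite divr_gt0.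
have tE : t * (kappa + gap h i) = kappa by rewrite divfK // gt_eqF.
clearbody t.
have tg : (1 - t) * kappa = t * gap h i by move: tE; lra.
have t1 : 0 < 1 - t by rewrite -(pmulr_lgt0 _ k0) tg mulr_gt0.
have N0 : 0 < 2 * (1 - t) * t * gap h i - (1 - t) ^+ 2 * kappa.
  have -> : (1 - t) ^+ 2 * kappa = (1 - t) * (t * gap h i) by rewrite -tg; ring.
  have := mulr_gt0 t1 (mulr_gt0 t0 g0); lra.
have inH3 (u : R) : 1 - dot ((1 - u) *: v h + u *: v i) ((1 - u) *: v h + u *: v i)
    = 2 * (1 - u) * u * gap h i - (1 - u) ^+ 2 * kappa.
  have := one_sub_norm_hyper (1 - u) ih; rewrite subKr (addrC (u *: v i)) => ->; ring.
have hor (u : R) : dot ((1 - u) *: v h + u *: v i) (v h)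
    = 1 + (1 - u) * kappa - u * gap h i.
  by rewrite !dot_lin dot_kappa (dotC (v i)) dot_gap; ring.
rewrite /foot /end_surface eqxx; apply: xget_unique.
  split; first split.
  - by exists t => //; move: t0 t1; lra.
  - by rewrite /H3 /= -subr_gt0 inH3.
  split; first by rewrite /H3 /= -subr_gt0 inH3.
  by rewrite hor tg addrK.
move=> _ [[[u /andP[u0 u1] ->]]] _ [_]; rewrite hor => E.
suff -> : u = t by [].
by apply: (mulIf (lt0r_neq0 den0)); rewrite tE; move: E; lra.
Qed.

End Tetrahedron.

Section EdgeLengths.
Variables (R : realType) (h : 'I_4) (P : decorated_tetrahedron R h).
Implicit Types (i j k l : 'I_4) (s t : R).

Local Notation v := (vtx P).
Local Notation sz := (hsize P).
Local Notation gap := (gap P).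
Local Notation kappa := (kappa P).

(** The hyperbolic cosine of the distance is [(T + T^-1) / 2] for
    [T = gap i j / (2 * sz i * sz j)]. *)
Lemma hdist_ideal i j : i != h -> j != h -> i != j ->
  hdist (foot P i j) (foot P j i) = `|ln (gap i j / (2 * sz i * sz j))|.
Proof.
move=> ih jh ij; have ji : j != i by rewrite eq_sym.
have g0 := gap_ideal_gt0 P ih jh ij.
have si := hsize_gt0 P ih; have sj := hsize_gt0 P jh.
rewrite footE_ideal // footE_ideal // (gapC P j i) /hdist.
rewrite one_sub_norm_ideal // one_sub_norm_ideal // (gapC P j i).
rewrite !dot_lin !vtx_ideal // (dotC (v j)) dot_gap.
move: g0 si sj; move: (gap i j) (sz i) (sz j) => g a b g0 a0 b0.
have da : 0 < g + 2 * a ^+ 2 by rewrite addr_gt0 // mulr_gt0 // exprn_gt0.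
have db : 0 < g + 2 * b ^+ 2 by rewrite addr_gt0 // mulr_gt0 // exprn_gt0.
rewrite -arcosh_half_sum; last by rewrite divr_gt0 // !mulr_gt0.
congr arcosh.
(* On a horosphere [1 - dot x x] is the square of [(1 - dot x v) / s], so the root of the product is
   rational in the data. *)
rewrite (@sqrtr_eq _ _ (4 * a * b * g ^+ 2
    / ((g + 2 * a ^+ 2) * (g + 2 * b ^+ 2)))).
- by field; rewrite !gt_eqF.
- by rewrite divr_ge0 ?mulr_ge0 ?exprn_ge0 ?ltW.
- by field; rewrite !gt_eqF.
Qed.

Lemma hdist_hyper i : i != h ->
  hdist (foot P h i) (foot P i h) = `|ln (gap h i / (sz i * Num.sqrt kappa))|.
Proof.
move=> ih; have g0 := gap_hyper_gt0 P ih; have s0 := hsize_gt0 P ih.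
have k0 := kappa_gt0 P.
have kg : 0 < kappa + gap h i by rewrite addr_gt0.
have footE : foot P h i = (1 - gap h i / (kappa + gap h i)) *: v i
    + (gap h i / (kappa + gap h i)) *: v h.
  by rewrite footE_hyper // addrC; congr (_ *: _ + _ *: _); field; rewrite gt_eqF.
rewrite footE footE_ideal_hyper // /hdist !one_sub_norm_hyper //.
rewrite !dot_lin (vtx_ideal P ih) (dotC (v i)) dot_gap dot_kappa.
have : Num.sqrt kappa ^+ 2 = kappa by rewrite sqr_sqrtr ?ltW.
have : 0 < Num.sqrt kappa by rewrite sqrtr_gt0.
clear footE; move: kg g0 s0 k0; move: (gap h i) (sz i) kappa => g s k kg g0 s0 k0.
move: (Num.sqrt k) => q q0 q2; rewrite -q2 in k0 kg *.
have den0 : 0 < g ^+ 2 + 2 * s ^+ 2 * g + s ^+ 2 * q ^+ 2.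
  by rewrite !addr_gt0 ?mulr_gt0 ?exprn_gt0.
rewrite -arcosh_half_sum; last by rewrite divr_gt0 // !mulr_gt0.
congr arcosh.
rewrite (@sqrtr_eq _ _ (2 * s * g ^+ 3 * q / ((q ^+ 2 + g)
   * (g ^+ 2 + 2 * s ^+ 2 * g + s ^+ 2 * q ^+ 2)))).
- by field; rewrite exprMn !gt_eqF.
- by rewrite divr_ge0 ?mulr_ge0 ?exprn_ge0 ?ltW.
- by field; rewrite exprMn !gt_eqF.
Qed.

Lemma edge_lengthC i j : edge_length P i j = edge_length P j i.
Proof.
rewrite /edge_length hdistC; suff -> : positive_length P i j = positive_length P j i by [].
rewrite /positive_length; have [->|ih] := eqVneq i h; have [->|jh] := eqVneq j h => //.
by rewrite setIC.
Qed.

(* At [t = 1] the two cases agree, so [positive_length] may hold or not. *)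
Lemma signed_abs_ln (t : R) (Q : Prop) : 0 < t ->
  (1 < t -> Q) -> (t < 1 -> ~ Q) ->
  (if `[< Q >] then `|ln t| else - `|ln t|) = ln t.
Proof.
move=> t0 tQ tnQ; have [t1|t1|->] := ltgtP t 1; last by rewrite ln1 normr0 oppr0 if_same.
  by rewrite asboolF ?ler0_norm ?opprK ?ln_le0 ?ltW //; exact: tnQ.
by rewrite asboolT ?ger0_norm ?ln_ge0 ?ltW //; exact: tQ.
Qed.

Lemma edge_length_hyper i : i != h ->
  edge_length P h i = ln (gap h i / (sz i * Num.sqrt kappa)).
Proof.
move=> ih; have g0 := gap_hyper_gt0 P ih; have s0 := hsize_gt0 P ih.
have k0 := kappa_gt0 P; have q0 : 0 < Num.sqrt kappa by rewrite sqrtr_gt0.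
rewrite /edge_length hdist_hyper //.
(* The truncating plane's foot is in the horoball exactly when the logarithm is at most 0, which
   settles the sign of the length. *)
have horoE : closed_horoball (v i) (sz i) (foot P h i) <-> gap h i <= sz i * Num.sqrt kappa.
  have kg : 0 < kappa + gap h i by rewrite addr_gt0.
  have footE : foot P h i = (1 - gap h i / (kappa + gap h i)) *: v i
      + (gap h i / (kappa + gap h i)) *: v h.
    by rewrite footE_hyper // addrC; congr (_ *: _ + _ *: _); field; rewrite gt_eqF.
  have normE : 1 - dot (foot P h i) (foot P h i)
      = (gap h i / (kappa + gap h i) * Num.sqrt kappa) ^+ 2.
    rewrite footE one_sub_norm_hyper // [RHS]exprMn sqr_sqrtr ?ltW //.
    by field; rewrite gt_eqF.
  rewrite /closed_horoball /H3 /= normE sqrtr_sqr ger0_norm; last first.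
    by rewrite mulr_ge0 ?divr_ge0 ?ltW.
  have -> : 1 - dot (foot P h i) (v i) = gap h i / (kappa + gap h i) * gap h i.
    by rewrite footE !dot_lin vtx_ideal // dot_gap; ring.
  rewrite mulrCA ler_pM2l ?divr_gt0 //; split=> [[]//|le]; split => //.
  by rewrite -subr_gt0 normE exprn_gt0 // mulr_gt0 // divr_gt0.
apply: signed_abs_ln; rewrite ?divr_gt0 ?mulr_gt0 // /positive_length eqxx.
  by rewrite ltr_pdivlMr ?mulr_gt0 // mul1r horoE leNgt => ->.
by rewrite ltr_pdivrMr ?mulr_gt0 // mul1r horoE => /ltW ? /(_ _)[].
Qed.

Lemma third_ideal i j : i != h -> j != h -> i != j ->
  exists k, [/\ k != h, k != i & k != j].
Proof.
move=> ih jh ij; have : (0 < #|~: [set h; i; j]%SET|)%N.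
  rewrite cardsCs finset.setCK card_ord subn_gt0.
  by rewrite (leq_ltn_trans (leq_card_setU _ _)) // cards1 cards2 ltnS; case: (h != i).
by case/card_gt0P => k; rewrite !inE -!orbA !negb_or => /and3P[? ? ?]; exists k.
Qed.

(** A common point gives the bound by [horosphere_product]. Conversely, a common point is
    constructed in the plane of three ideal vertices. *)
Lemma horospheres_disjoint i j : i != h -> j != h -> i != j ->
  (horosphere (v i) (sz i) `&` horosphere (v j) (sz j) = set0)
  <-> 2 * sz i * sz j < gap i j.
Proof.
move=> ih jh ij; have g0 := gap_ideal_gt0 P ih jh ij.
have si := hsize_gt0 P ih; have sj := hsize_gt0 P jh.
split=> [disj|lt].
  rewrite ltNge; apply/negP => le.
  have [k [kh ki kj]] := third_ideal ih jh ij.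
  have gik : 0 < gap i k by apply: gap_ideal_gt0 => //; rewrite eq_sym.
  have gjk : 0 < gap j k by apply: gap_ideal_gt0 => //; rewrite eq_sym.
  (* With lifts written as capitals, [n = V_k - a V_i - b V_j] is Minkowski orthogonal to [V_i] and
     [V_j], and its square is [2 * a * b * gap i j]. *)
  pose a := gap j k / gap i j; pose b := gap i k / gap i j.
  (* The vector [(sz j / gap i j) V_i + (sz i / gap i j) V_j + c n] has the prescribed products with
     [V_i] and [V_j]. The equation on [c] gives it Minkowski square -1, and the sign of [c] makes
     its last coordinate [N] positive; [x] is its central projection. *)
  have [c c2 cN] : exists2 c, 2 * a * b * gap i j * c ^+ 2
      = 2 * sz i * sz j / gap i j - 1 & 0 <= c * (1 - a - b).
    pose c := Num.sqrt ((2 * sz i * sz j / gap i j - 1) / (2 * a * b * gap i j)).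
    have abg : 0 < 2 * a * b * gap i j by rewrite !mulr_gt0 ?invr_gt0.
    have c2 : 2 * a * b * gap i j * c ^+ 2 = 2 * sz i * sz j / gap i j - 1.
      rewrite sqr_sqrtr ?divr_ge0 ?(ltW abg) ?subr_ge0 ?ler_pdivlMr ?mul1r //.
      by rewrite mulrC divfK ?gt_eqF.
    have [ab1|ab1] := leP 0 (1 - a - b).
      by exists c => //; rewrite mulr_ge0 ?sqrtr_ge0.
    by exists (- c); rewrite ?sqrrN // mulNr -mulrN mulr_ge0 ?sqrtr_ge0 ?oppr_ge0 ?ltW.
  pose al := sz j / gap i j - c * a; pose be := sz i / gap i j - c * b.
  pose N := al + be + c.
  have N0 : 0 < N.
    rewrite (_ : N = sz i / gap i j + sz j / gap i j + c * (1 - a - b)).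
      by rewrite ltr_wpDr // addr_gt0 ?divr_gt0.
    by rewrite /N /al /be; ring.
  pose x := N^-1 *: (al *: v i + be *: v j + c *: v k).
  have xi : 1 - dot x (v i) = sz i / N.
    rewrite !dot_lin (vtx_ideal P ih) (dotC (v j)) (dotC (v k)) !dot_gap.
    apply: (mulIf (lt0r_neq0 N0)); rewrite divfK ?gt_eqF // mulrBl mul1r.
    rewrite mulrAC mulVf ?gt_eqF // mul1r.
    rewrite /N (_ : sz i = be * gap i j + c * gap i k); first by ring.
    by rewrite /be /b; field; rewrite gt_eqF.
  have xj : 1 - dot x (v j) = sz j / N.
    rewrite !dot_lin (vtx_ideal P jh) (dotC (v k)) !dot_gap.
    apply: (mulIf (lt0r_neq0 N0)); rewrite divfK ?gt_eqF // mulrBl mul1r.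
    rewrite mulrAC mulVf ?gt_eqF // mul1r.
    rewrite /N (_ : sz j = al * gap i j + c * gap j k); first by ring.
    by rewrite /al /a; field; rewrite gt_eqF.
  have xx : 1 - dot x x = N^-1 ^+ 2.
    rewrite {2}/x dotZr !dotDr !dotZr.
    have -> : dot x (v i) = 1 - sz i / N by rewrite -xi subKr.
    have -> : dot x (v j) = 1 - sz j / N by rewrite -xj subKr.
    have -> : dot x (v k) = 1 - (al * gap i k + be * gap j k) / N.
      rewrite /x !dot_lin (vtx_ideal P kh) !dot_gap.
      by rewrite /N; field; rewrite -/N gt_eqF.
    transitivity ((al * sz i + be * sz j + c * (al * gap i k + be * gap j k)) / N ^+ 2).
      rewrite [X in 1 - _ * X](_ : _ = N - (al * sz i + be * sz j
          + c * (al * gap i k + be * gap j k)) / N); last by rewrite /N; field; rewrite gt_eqF.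
      by field; rewrite gt_eqF.
    rewrite exprVn (_ : al * _ + _ + _ = 1) ?mul1r //.
    rewrite (_ : _ + _ = 2 * sz i * sz j / gap i j - 2 * a * b * gap i j * c ^+ 2).
      by rewrite c2 subKr.
    by rewrite /al /be /a /b; field; rewrite gt_eqF.
  have x0 : H3 x by rewrite /H3 /= -subr_gt0 xx exprn_gt0 // invr_gt0.
  suff : (horosphere (v i) (sz i) `&` horosphere (v j) (sz j)) x by rewrite disj.
  rewrite /horosphere /= xi xj xx sqrtr_sqr ger0_norm ?invr_ge0 ?ltW //.
rewrite -subset0 => x [[x1 xi] [_ xj]].
have x0 : 0 < 1 - dot x x by rewrite subr_gt0.
have := @horosphere_product _ (v i) (v j) x (vtx_ideal P ih) (vtx_ideal P jh).
rewrite dot_gap gtrBl subKr xi xj => /(_ g0).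
rewrite [leRHS](_ : _ = Num.sqrt (1 - dot x x) ^+ 2 * (2 * sz i * sz j)); last by ring.
by rewrite (sqr_sqrtr (ltW x0)) ler_pM2l // leNgt lt.
Qed.

Lemma edge_length_ideal i j : i != h -> j != h -> i != j ->
  edge_length P i j = ln (gap i j / (2 * sz i * sz j)).
Proof.
move=> ih jh ij; have g0 := gap_ideal_gt0 P ih jh ij.
have si := hsize_gt0 P ih; have sj := hsize_gt0 P jh.
rewrite /edge_length hdist_ideal //.
have pE := horospheres_disjoint ih jh ij.
apply: signed_abs_ln; rewrite ?divr_gt0 ?mulr_gt0 //
  /positive_length /end_surface (negbTE ih) (negbTE jh).
  by rewrite ltr_pdivlMr ?mulr_gt0 // mul1r => /pE.
by rewrite ltr_pdivrMr ?mulr_gt0 // mul1r => /ltW; rewrite leNgt => /negP + /pE.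
Qed.

End EdgeLengths.

(** * Dihedral angles of a tetrahedron *)

Section FourVertices.
Variables i j k l : 'I_4.
Hypothesis ijkl : uniq [:: i; j; k; l].

Lemma mem_four m : m \in [:: i; j; k; l].
Proof.
have cardE : #|[:: i; j; k; l]| = #|'I_4| by rewrite (card_uniqP ijkl) card_ord.
have /(subset_cardP cardE)-> // : [:: i; j; k; l] \subset 'I_4 by exact: subset_predT.
Qed.

Lemma perm_index_four : perm_eq (index_enum 'I_4) [:: i; j; k; l].
Proof.
apply: uniq_perm => //; first exact: index_enum_uniq.
by move=> m; rewrite mem_four mem_index_enum.
Qed.

Lemma sum_four (V : zmodType) (F : 'I_4 -> V) :
  \sum_m F m = F i + F j + F k + F l.
Proof.
by rewrite (perm_big _ perm_index_four) !big_cons big_nil /= addr0 !addrA.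
Qed.

Lemma enum_opposite : enum (~: [set i; j])%SET = [:: k; l]
  \/ enum (~: [set i; j])%SET = [:: l; k].
Proof.
have /and4P[] := ijkl; rewrite !inE !negb_or => /and3P[ij ik il] /andP[jk jl] kl _.
have : perm_eq (enum (~: [set i; j])%SET) [:: k; l].
  apply: uniq_perm; [exact: enum_uniq | by rewrite /= inE kl |].
  move=> m; rewrite mem_enum !inE.
  have := mem_four m; rewrite !inE => /or4P[]/eqP->.
  - by rewrite eqxx (negbTE ik) (negbTE il).
  - by rewrite eqxx orbT (negbTE jk) (negbTE jl).
  - by rewrite eqxx eq_sym (negbTE ik) eq_sym (negbTE jk).
  - by rewrite eqxx orbT eq_sym (negbTE il) eq_sym (negbTE jl).
move=> kl_perm; have := perm_size kl_perm; have := perm_uniq kl_perm.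
have := perm_mem kl_perm; rewrite [uniq [:: k; l]]/= inE kl.
case: (enum _) => [//|x [//|y [|//]]] xy; rewrite /= inE => xney _.
have := xy x; have := xy y; rewrite !inE !eqxx /= orbT.
move=> /esym/orP[]/eqP yE /esym/orP[]/eqP xE; subst x y; [|right|left|] => //;
  by rewrite eqxx in xney.
Qed.
End FourVertices.

Section DihedralAngles.
Variables (R : realType) (h : 'I_4) (P : decorated_tetrahedron R h).
Implicit Types (i j k l : 'I_4) (s t : R).

Local Notation v := (vtx P).
Local Notation sz := (hsize P).
Local Notation gap := (gap P).
Local Notation kappa := (kappa P).

Lemma gap_gt0 i j : i != j -> 0 < gap i j.
Proof.
have [->|ih] := eqVneq i h; first by rewrite eq_sym; exact: gap_hyper_gt0.
have [->|jh] := eqVneq j h; first by rewrite gapC; exact: gap_hyper_gt0.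
exact: gap_ideal_gt0.
Qed.

(** At least one end is ideal, so only minus the square of the gap remains. *)
Lemma edge_det_lt0 i j : i != j ->
  (dot (v i) (v i) - 1) * (dot (v j) (v j) - 1) - (dot (v i) (v j) - 1) ^+ 2 < 0.
Proof.
move=> ij; have g0 := gap_gt0 ij.
have -> : (dot (v i) (v i) - 1) * (dot (v j) (v j) - 1) = 0.
  have [ih|ih] := eqVneq i h; last by rewrite vtx_ideal // subrr mul0r.
  by rewrite (@vtx_ideal _ _ P j) -?ih 1?eq_sym // subrr mulr0.
by rewrite sub0r oppr_lt0 -sqrrN opprB exprn_gt0.
Qed.

(** The enumeration may list [k] and [l] in either order, but the formula is symmetric in them. *)
Lemma dihedral_angleE i j k l : uniq [:: i; j; k; l] ->
  0 <= edge_form (v i) (v j) (v k) (v k) ->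
  0 <= edge_form (v i) (v j) (v l) (v l) ->
  dihedral_angle P i j = acos (edge_form (v i) (v j) (v k) (v l)
    / Num.sqrt (edge_form (v i) (v j) (v k) (v k)
                * edge_form (v i) (v j) (v l) (v l))).
Proof.
move=> ijkl kk ll.
have /and4P[] := ijkl; rewrite !inE !negb_or => /and3P[ij ik il] /andP[jk jl] kl _.
have [x xP] := vtx_edges_meet_H3 P ij.
have : tetra_edge P i j (xget 0 (tetra_edge P i j)).
  by apply: (xgetPex 0); exists x.
rewrite /dihedral_angle; set p := xget _ _ => -[[t t01 pE] p1].
have [-> | ->] := enum_opposite ijkl.
  by rewrite pE kangle_orth_edge -?pE // edge_det_lt0.
rewrite pE kangle_orth_edge -?pE ?edge_det_lt0 //.
by rewrite edge_formCr (mulrC (edge_form _ _ (v l) _)).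
Qed.

Lemma edge_form_ideal i j k l : i != h -> j != h -> i != j ->
  edge_form (v i) (v j) (v k) (v l) = dot (v k) (v l) - 1
    + (gap i k * gap j l + gap j k * gap i l) / gap i j.
Proof.
move=> ih jh ij; have g0 := gap_gt0 ij.
rewrite /edge_form (vtx_ideal P ih) (vtx_ideal P jh) !(dotC _ (v i)) !(dotC _ (v j)).
rewrite (dotC (v j) (v i)) !dot_gap.
have n0 : 1 - gap i j - 1 != 0.
  by rewrite (_ : _ - 1 = - gap i j) ?oppr_eq0 ?gt_eqF //; ring.
by field; rewrite ?n0 gt_eqF.
Qed.

Lemma edge_form_hyper i k l : i != h ->
  edge_form (v h) (v i) (v k) (v l) = dot (v k) (v l) - 1
    + (gap h k * gap i l + gap i k * gap h l) / gap h i
    + kappa * gap i k * gap i l / gap h i ^+ 2.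
Proof.
move=> ih; have g0 := gap_hyper_gt0 P ih.
rewrite /edge_form (vtx_ideal P ih) dot_kappa !(dotC _ (v h)) !(dotC _ (v i)).
rewrite (dotC (v i) (v h)) !dot_gap.
have n0 : 1 - gap h i - 1 != 0.
  by rewrite (_ : _ - 1 = - gap h i) ?oppr_eq0 ?gt_eqF //; ring.
by field; rewrite ?n0 gt_eqF.
Qed.

Lemma acosr_scale (m e n w : R) : 0 < m -> n = m * e ->
  acos (e / Num.sqrt w) = acos (n / Num.sqrt (m ^+ 2 * w)).
Proof.
move=> m0 ->; rewrite sqrtrM ?sqr_ge0 // sqrtr_sqr gtr0_norm //.
by rewrite -mulf_div divff ?mul1r // gt_eqF.
Qed.

(* The value of [cosh d - 1] for the length d of the side opposite to a of the
   truncation triangle. *)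
Definition side (a b c : 'I_4) : R := kappa * gap b c / (gap h b * gap h c).

Section Labelled.
Variables a b c : 'I_4.
Hypothesis habc : uniq [:: h; a; b; c].

Lemma labels_neq : [/\ a != h, b != h & c != h] /\ [/\ a != b, a != c & b != c].
Proof.
have /and4P[] := habc; rewrite !inE !negb_or => /and3P[? ? ?] /andP[? ?] ? _.
by split; split; rewrite // eq_sym.
Qed.

Lemma side_gt0 : 0 < side a b c.
Proof.
have [[? ? ?] [? ? ?]] := labels_neq.
by rewrite divr_gt0 ?mulr_gt0 ?kappa_gt0 ?gap_gt0 // eq_sym.
Qed.

Lemma dihedral_angle_ideal :
  dihedral_angle P b c = ideal_angle (side a b c) (side b a c) (side c a b).
Proof.
have [[ah bh ch] [ab ac bc]] := labels_neq.
have [ba ca cb] : [/\ b != a, c != a & c != b] by split; rewrite eq_sym.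
have k0 := kappa_gt0 P.
have [ga gb gc] : [/\ 0 < gap h a, 0 < gap h b & 0 < gap h c].
  by split; apply: gap_hyper_gt0.
have [gab gac gbc] : [/\ 0 < gap a b, 0 < gap a c & 0 < gap b c].
  by split; apply: gap_gt0.
have aaE : edge_form (v b) (v c) (v a) (v a) = 2 * gap a b * gap a c / gap b c.
  rewrite edge_form_ideal // vtx_ideal // subrr add0r (gapC _ b a) (gapC _ c a).
  by field; rewrite gt_eqF.
have hhE : edge_form (v b) (v c) (v h) (v h) = kappa + 2 * gap h b * gap h c / gap b c.
  rewrite edge_form_ideal // dot_kappa (gapC _ b h) (gapC _ c h).
  by field; rewrite gt_eqF.
have aa0 : 0 <= edge_form (v b) (v c) (v a) (v a).
  by rewrite aaE divr_ge0 ?mulr_ge0 ?ltW.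
have hh0 : 0 <= edge_form (v b) (v c) (v h) (v h).
  by rewrite hhE addr_ge0 ?divr_ge0 ?mulr_ge0 ?ltW.
rewrite (@dihedral_angleE b c a h) //; last first.
  by rewrite /= !inE !negb_or bc ba bh ca ch ah.
(* This factor turns the products of gaps into sides of the truncation triangle. *)
rewrite (@acosr_scale (kappa * gap b c / (gap h a * gap h b * gap h c)) _
   (side b a c + side c a b - side a b c)).
- rewrite aaE hhE /ideal_angle /side; congr (acos (_ / Num.sqrt _)).
  by field; rewrite !gt_eqF.
- by rewrite divr_gt0 ?mulr_gt0.
- rewrite edge_form_ideal // /side (gapC _ b a) (gapC _ c a) (gapC _ b h)
    (gapC _ c h) dot_gap (gapC _ a h).
  by field; rewrite !gt_eqF.
Qed.

Lemma dihedral_angle_hyper :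
  dihedral_angle P h a = hyper_angle (side a b c) (side b a c) (side c a b).
Proof.
have [[ah bh ch] [ab ac bc]] := labels_neq.
have [ba ca cb] : [/\ b != a, c != a & c != b] by split; rewrite eq_sym.
have k0 := kappa_gt0 P.
have [ga gb gc] : [/\ 0 < gap h a, 0 < gap h b & 0 < gap h c].
  by split; apply: gap_hyper_gt0.
have [gab gac gbc] : [/\ 0 < gap a b, 0 < gap a c & 0 < gap b c].
  by split; apply: gap_gt0.
have bbE : edge_form (v h) (v a) (v b) (v b)
    = 2 * gap h b * gap a b / gap h a + kappa * gap a b ^+ 2 / gap h a ^+ 2.
  by rewrite edge_form_hyper // vtx_ideal // subrr add0r; field; rewrite gt_eqF.
have ccE : edge_form (v h) (v a) (v c) (v c)
    = 2 * gap h c * gap a c / gap h a + kappa * gap a c ^+ 2 / gap h a ^+ 2.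
  by rewrite edge_form_hyper // vtx_ideal // subrr add0r; field; rewrite gt_eqF.
have bb0 : 0 <= edge_form (v h) (v a) (v b) (v b).
  by rewrite bbE addr_ge0 ?divr_ge0 ?mulr_ge0 ?exprn_ge0 ?ltW.
have cc0 : 0 <= edge_form (v h) (v a) (v c) (v c).
  by rewrite ccE addr_ge0 ?divr_ge0 ?mulr_ge0 ?exprn_ge0 ?ltW.
rewrite (@dihedral_angleE h a b c) //.
rewrite (@acosr_scale (kappa / (gap h b * gap h c)) _
  (side b a c + side c a b + side b a c * side c a b - side a b c)).
- rewrite bbE ccE /hyper_angle /side; congr (acos (_ / Num.sqrt _)).
  by field; rewrite !gt_eqF.
- by rewrite divr_gt0 ?mulr_gt0.
- by rewrite edge_form_hyper // /side dot_gap; field; rewrite !gt_eqF.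
Qed.

(** Affine independence enters here: up to a positive factor, the Gram determinant is the Euclidean
    square of a combination of the vertices with coefficient sum 0 and a nonzero coefficient at
    [v h]. *)
Lemma gram13_side_gt0 : 0 < gram13 (side a b c) (side b a c) (side c a b).
Proof.
have [[ah bh ch] [ab ac bc]] := labels_neq.
have [ba ca cb] : [/\ b != a, c != a & c != b] by split; rewrite eq_sym.
have k0 := kappa_gt0 P.
have [ga gb gc] : [/\ 0 < gap h a, 0 < gap h b & 0 < gap h c].
  by split; apply: gap_hyper_gt0.
have [gab gac gbc] : [/\ 0 < gap a b, 0 < gap a c & 0 < gap b c].
  by split; apply: gap_gt0.
(* [e *: n_h - f *: n_c + ...] is e times the projection of the lift of v_h to the
   Minkowski orthogonal of those of v_a, v_b and v_c; it is spacelike, and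
   modulo the lift of v_a it is the vector z below. *)
pose e := 2 * gap a c * gap b c / gap a b.
pose f := - gap h c + (gap a c * gap h b + gap b c * gap h a) / gap a b.
pose g := (f * gap a c - e * gap h a) / gap a b.
pose z := e *: v h - f *: v c + g *: v b - (e - f + g) *: v a.
have e0 : 0 < e by rewrite divr_gt0 ?mulr_gt0.
have z0 : z != 0.
  apply/eqP => z0.
  pose w m : R := if m == h then e else if m == c then - f else if m == b then g
    else - (e - f + g).
  have [wh wa wb wc] : [/\ w h = e, w a = - (e - f + g), w b = g & w c = - f].
    rewrite /w !eqxx (negbTE ah) (negbTE bh) (negbTE ch) (negbTE ab) (negbTE ac).
    by rewrite (negbTE bc).
  have w0 : w h = 0.
    apply: (@vtx_free _ _ P); rewrite (sum_four habc) wh wa wb wc; first by ring.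
    rewrite -[RHS]z0 /z !scaleNr.
    by rewrite -!addrA; congr (_ + _); rewrite addrC (addrC (g *: _)) -addrA.
  by move: e0; rewrite -wh w0 ltxx.
have := dot_gt0 z0.
have -> : dot z z = e * ((gap h a * gap h b * gap h c
      / (kappa * gap a b)) ^+ 2 * gram13 (side a b c) (side b a c) (side c a b)).
  rewrite /z !dot_lin (vtx_ideal P ah) (vtx_ideal P bh) (vtx_ideal P ch).
  rewrite dot_kappa (dotC (v b) (v a)) (dotC (v c) (v a)) (dotC (v c) (v b)).
  rewrite !(dotC _ (v h)) !dot_gap /gram13 /side /g /f /e.
  by field; rewrite !gt_eqF.
by rewrite (pmulr_rgt0 _ e0) pmulr_rgt0 // exprn_gt0 // divr_gt0 ?mulr_gt0.
Qed.

End Labelled.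
End DihedralAngles.

Lemma orth_compN (R : realType) (p d u : 'rV[R]_3) :
  orth_comp p (- d) u = orth_comp p d u.
Proof.
have -> : orth_comp p (- d) u = u - (kmetric p u (- d) / kmetric p (- d) (- d)) *: - d by [].
have -> : kmetric p (- d) (- d) = kmetric p d d by rewrite /kmetric !dot_lin; ring.
have -> : kmetric p u (- d) = - kmetric p u d by rewrite /kmetric !dot_lin; ring.
by rewrite mulNr scalerN scaleNr opprK.
Qed.

Lemma dihedral_angleC (R : realType) (h : 'I_4) (P : decorated_tetrahedron R h) i j :
  dihedral_angle P i j = dihedral_angle P j i.
Proof.
have [->//|ij] := eqVneq i j.
have size2 : size (enum (~: [set i; j])%SET) = 2.
  by rewrite -cardE cardsCs finset.setCK card_ord cards2 ij.
rewrite /dihedral_angle (_ : [set j; i]%SET = [set i; j]%SET); last exact: finset.setUC.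
rewrite (_ : tetra_edge P j i = tetra_edge P i j); last by rewrite /tetra_edge segmentC.
(* Swapping the ends changes the default of [nth], which is never returned since two labels
   remain. *)
by rewrite -[vtx P j - vtx P i]opprB !orth_compN !(set_nth_default j i) ?size2.
Qed.

(** The horosphere sizes cancel in the first term; the other two vanish when the horospheres touch
    the truncating plane. *)
Lemma edge_length_side (R : realType) (h a b c : 'I_4) (P : decorated_tetrahedron R h) :
  uniq [:: h; a; b; c] ->
  edge_length P b c = ln (side P a b c / 2) + edge_length P h b + edge_length P h c.
Proof.
move=> habc; have [[ah bh ch] [ab ac bc]] := labels_neq habc.
have [gb gc] : 0 < gap P h b /\ 0 < gap P h c by split; apply: gap_hyper_gt0.
have gbc := gap_gt0 P bc; have k0 := kappa_gt0 P.
have q0 : 0 < Num.sqrt (kappa P) by rewrite sqrtr_gt0.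
have [sb sc] : 0 < hsize P b /\ 0 < hsize P c by split; apply: hsize_gt0.
rewrite edge_length_ideal // !edge_length_hyper //.
have s0 : 0 < side P a b c / 2 by rewrite divr_gt0 // side_gt0.
have lb0 : 0 < gap P h b / (hsize P b * Num.sqrt (kappa P)).
  by rewrite divr_gt0 ?mulr_gt0.
have lc0 : 0 < gap P h c / (hsize P c * Num.sqrt (kappa P)).
  by rewrite divr_gt0 ?mulr_gt0.
rewrite -(lnM s0 lb0) -(lnM (mulr_gt0 s0 lb0) lc0); congr ln.
rewrite /side -[X in X * gap P b c](sqr_sqrtr (ltW k0)).
by field; rewrite !gt_eqF.
Qed.

(** The numerical order of [h], [a], [b], [c] is unknown, so the sum is doubled to one over all
    ordered pairs of distinct labels. *)
Lemma sum_pairs (R : realType) (F : 'I_4 -> 'I_4 -> R) (h a b c : 'I_4) :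
  uniq [:: h; a; b; c] -> (forall i j, F i j = F j i) ->
  \sum_(i < 4) \sum_(j < 4 | (i < j)%N) F i j
  = F h a + F h b + F h c + F b c + F a c + F a b.
Proof.
move=> habc FC; set S := LHS.
have SE : S + S = \sum_(i < 4) \sum_(j < 4 | j != i) F i j.
  rewrite {2}/S (exchange_big_dep xpredT) //= -big_split; apply: eq_bigr => i _ /=.
  rewrite [RHS](bigID (fun j : 'I_4 => (i < j)%N)) /=; congr (_ + _).
    by apply: eq_bigl => j; rewrite andbC -val_eqE /= neq_ltn; case: ltngtP.
  rewrite (eq_bigr (F i)) => [|j _]; last exact: FC.
  by apply: eq_bigl => j; rewrite -val_eqE /= neq_ltn; case: ltngtP.
have sumE i : \sum_(j < 4 | j != i) F i j = \sum_(j < 4) F i j - F i i.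
  by rewrite [in RHS](bigD1 i) //= addrAC subrr add0r.
move: SE; under eq_bigr do rewrite sumE.
rewrite sumrB (sum_four habc) !(sum_four habc) (FC a h) (FC b h) (FC c h).
rewrite (FC b a) (FC c a) (FC c b); lra.
Qed.

(** * The length-angle pairing of two tetrahedra *)

Section Monotonicity.
Variables (R : realType) (h : 'I_4) (P Q : decorated_tetrahedron R h).
Implicit Types i j : 'I_4.

Definition length_angle_pairing : R := \sum_(i < 4) \sum_(j < 4 | (i < j)%N)
  (edge_length P i j - edge_length Q i j)
  * (dihedral_angle P i j - dihedral_angle Q i j).

(** The pairing reduces to the expression of [log_ratio_monotone]. If it vanishes the angles agree,
    hence so do the sides, and only the lengths at [h] can differ freely. *)
Lemma length_angle_pairing_ge0 (a b c : 'I_4) : uniq [:: h; a; b; c] ->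
  0 <= length_angle_pairing /\ (length_angle_pairing = 0 ->
    edge_length P b c - edge_length Q b c
    = (edge_length P h b - edge_length Q h b)
      + (edge_length P h c - edge_length Q h c)).
Proof.
move=> habc.
have hbac : uniq [:: h; b; a; c].
  rewrite (perm_uniq (_ : perm_eq _ [:: h; a; b; c])) // perm_cons.
  by rewrite (perm_catCA [:: b] [:: a] [:: c]).
have hcab : uniq [:: h; c; a; b].
  rewrite (perm_uniq (_ : perm_eq _ [:: h; a; b; c])) // perm_cons.
  by rewrite (perm_catC [:: c] [:: a; b]).
rewrite /length_angle_pairing (sum_pairs habc); last first.
  by move=> i j; rewrite !(edge_lengthC _ i) !(dihedral_angleC _ i).
rewrite (edge_length_side P habc) (edge_length_side Q habc).
have -> : edge_length P a c = ln (side P b a c / 2) + edge_length P h a + edge_length P h c.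
  exact: edge_length_side.
have -> : edge_length Q a c = ln (side Q b a c / 2) + edge_length Q h a + edge_length Q h c.
  exact: edge_length_side.
have -> : edge_length P a b = ln (side P c a b / 2) + edge_length P h a + edge_length P h b.
  exact: edge_length_side.
have -> : edge_length Q a b = ln (side Q c a b / 2) + edge_length Q h a + edge_length Q h b.
  exact: edge_length_side.
have anglesE (P' : decorated_tetrahedron R h) (p := dihedral_angle P' b c)
    (q := dihedral_angle P' a c) (r := dihedral_angle P' a b) :
  [/\ ideal_angles p q r, dihedral_angle P' h a = pi - q - r,
      dihedral_angle P' h b = pi - p - r, dihedral_angle P' h c = pi - p - q &
      [/\ ln (side P' a b c / 2) = log_ratio p q r,
          ln (side P' b a c / 2) = log_ratio q p r &
          ln (side P' c a b / 2) = log_ratio r p q]].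
  have sC x y z : side P' x z y = side P' x y z.
    by rewrite /side gapC (mulrC (gap _ _ z)).
  have gm := gram13_side_gt0 P' habc.
  have x0 := side_gt0 P' habc; have y0 := side_gt0 P' hbac; have z0 := side_gt0 P' hcab.
  rewrite /p /q /r (dihedral_angle_ideal P' habc) (dihedral_angle_ideal P' hbac).
  rewrite (dihedral_angle_ideal P' hcab) (dihedral_angle_hyper P' habc).
  rewrite (dihedral_angle_hyper P' hbac) (dihedral_angle_hyper P' hcab).
  rewrite (sC a b c) (sC b a c) (sC c a b).
  move: (side P' a b c) (side P' b a c) (side P' c a b) gm x0 y0 z0.
  move=> x y z gm x0 y0 z0.
  have [D hx hy hz lx] := angles_of_lengths x0 y0 z0 gm.
  have := angles_of_lengths y0 x0 z0; rewrite gram13C => /(_ gm)[_ _ _ _ ly].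
  have := angles_of_lengths z0 x0 y0; rewrite gram13CA => /(_ gm)[_ _ _ _ lz].
  split => //; split => //; first by rewrite ly (ideal_angleC z).
  by rewrite lz (ideal_angleC x) (ideal_angleC y).
have [D ha hb hc [lx ly lz]] := anglesE P.
have [D' ha' hb' hc' [lx' ly' lz']] := anglesE Q.
rewrite ha hb hc ha' hb' hc'.
move: D D' lx ly lz lx' ly' lz'; clear.
move: (ln (side P a b c / 2)) (ln (side P b a c / 2)) (ln (side P c a b / 2)).
move: (ln (side Q a b c / 2)) (ln (side Q b a c / 2)) (ln (side Q c a b / 2)).
move: (dihedral_angle P b c) (dihedral_angle P a c) (dihedral_angle P a b).
move: (dihedral_angle Q b c) (dihedral_angle Q a c) (dihedral_angle Q a b).
move: (edge_length P h a) (edge_length P h b) (edge_length P h c).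
move: (edge_length Q h a) (edge_length Q h b) (edge_length Q h c).
move=> la' lb' lc' la lb lc p' q' r' p q r x' y' z' x y z D D' lx ly lz lx' ly' lz'.
(* The increments of [la], [lb] and [lc] drop out: each multiplies the change of the angle sum at an
   ideal vertex, which is [pi] in both tetrahedra. *)
rewrite [X in 0 <= X /\ (X = 0 -> _)](_ : _ =
    (log_ratio p q r - log_ratio p' q' r') * (p - p')
  + (log_ratio q p r - log_ratio q' p' r') * (q - q')
  + (log_ratio r p q - log_ratio r' p' q') * (r - r')); last first.
  by rewrite -lx -ly -lz -lx' -ly' -lz'; ring.
have [pqr|/(log_ratio_monotone D' D)] := eqVneq (p', q', r') (p, q, r); last first.
  by move=> gt0; split; [exact: ltW | move=> eq0; rewrite eq0 ltxx in gt0].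
case: pqr lx' => -> -> -> lx'; rewrite !subrr !mul0r !addr0; split=> // _.
by rewrite lx lx'; ring.
Qed.
End Monotonicity.

(** * Gluing *)

Lemma fresh_label (s : seq 'I_4) : (size s < 4)%N -> exists k, k \notin s.
Proof.
move=> s4; apply/existsP; apply: contraLR s4; rewrite negb_exists -leqNgt => /forallP s4.
rewrite -[X in (X <= _)%N]card_ord; apply: leq_trans (card_size s).
by apply/subset_leq_card/fintype.subsetP => k _; rewrite -[_ \in _]negbK.
Qed.

Lemma complete_labels (i j : 'I_4) : i != j ->
  exists k l, uniq [:: i; j; k; l].
Proof.
move=> ij; have [k] := @fresh_label [:: i; j] isT; have [l] := @fresh_label [:: i; j; k] isT.
rewrite !inE !negb_or => /and3P[li lj lk] /andP[ki kj].
by exists k, l; rewrite /= !inE !negb_or ij ![_ == k]eq_sym ![_ == l]eq_sym ki kj li lj lk.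
Qed.

Section Gluing.
Variable T : triangulation.
Implicit Types (t : tetra T) (x y : simplex T) (i j f : 'I_4).

Lemma gluedP x y : reflect (exists f t' g, [/\ mate x.1 f = Some (t', g),
    f \notin x.2 & y = (t', (g @: x.2)%SET)]) (glued x y).
Proof.
apply: (iffP existsP) => [[f]|[f [t' [g [fE fx ->]]]]].
  case fE: (mate x.1 f) => [[t' g]|//] /andP[fx /eqP yE].
  by exists f, t', g.
by exists f; rewrite fE fx eqxx.
Qed.

Lemma glued_sym x y : glued x y -> glued y x.
Proof.
move=> /gluedP[f [t' [g [fE fx ->]]]]; apply/gluedP.
exists (g f), x.1, g^-1%g; split; rewrite /= ?(mate_sym fE) //.
  by rewrite mem_imset //; exact: perm_inj.
rewrite -imset_comp; case: (x) => t A /=; congr (_, _).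
rewrite (@eq_imset _ _ _ id) ?imset_id // => i /=; exact: permK.
Qed.

Lemma connect_glued_sym : connect_sym (@glued T).
Proof. by apply: sym_connect_sym => x y; apply/idP/idP; exact: glued_sym. Qed.

Lemma card_glued x y : connect (@glued T) x y -> #|y.2| = #|x.2|.
Proof.
move=> /connectP[s + ->]; elim: s x => [//|z s IH] x /= /andP[xz /IH ->].
by have /gluedP[f [t' [g [_ _ ->]]]] := xz; rewrite card_imset //; exact: perm_inj.
Qed.

Lemma cell_class_eq x y : connect (@glued T) x y -> cell_class x = cell_class y.
Proof.
move=> xy; apply/setP => z; rewrite !inE.
exact: (same_connect connect_glued_sym xy).
Qed.

Lemma edge_subproof t i j : i != j ->
  [exists y : simplex T, (#|y.2| == 2%N) &&
    (cell_class (t, [set i; j]%SET) == cell_class y)].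
Proof.
by move=> ij; apply/existsP; exists (t, [set i; j]%SET); rewrite /= cards2 ij eqxx.
Qed.

Definition edge t i j (ij : i != j) : E T :=
  Sub (cell_class (t, [set i; j]%SET)) (edge_subproof t ij).

Lemma edgeP (e : E T) : exists2 x : simplex T, #|x.2| = 2%N & val e = cell_class x.
Proof. by have /existsP[x /andP[/eqP ? /eqP ?]] := valP e; exists x. Qed.

Lemma in_edge_neq (e : E T) t i j : in_edge e t i j -> i != j.
Proof.
have [x x2 eE] := edgeP e.
rewrite /in_edge eE inE => /card_glued /=; rewrite x2 cards2.
by case: (i != j).
Qed.

Lemma in_edgeE (e : E T) t i j (ij : i != j) : in_edge e t i j = (e == edge t ij).
Proof.
have [x _ eE] := edgeP e; rewrite -val_eqE /in_edge eE /= inE.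
apply/idP/eqP => [/cell_class_eq //|E].
have : (t, [set i; j]%SET) \in cell_class (t, [set i; j]%SET) by rewrite inE.
by rewrite -E inE.
Qed.

Lemma in_edge_glued (e : E T) t f t' (g : {perm 'I_4}) i j :
  mate t f = Some (t', g) -> i != f -> j != f ->
  in_edge e t i j -> in_edge e t' (g i) (g j).
Proof.
move=> fE fi fj; have [x _ eE] := edgeP e.
rewrite /in_edge eE !inE => /connect_trans; apply; apply: connect1; apply/gluedP.
exists f, t', g; split => //=; first by rewrite !inE !(eq_sym f) negb_or fi.
by rewrite imsetU1 imset_set1.
Qed.

(** Each pair of labels of a tetrahedron lies in exactly one edge class, so the sum over [e]
    collapses. *)
Lemma sum_edges (R : realType) (F : E T -> tetra T -> 'I_4 -> 'I_4 -> R)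
    (G : tetra T -> 'I_4 -> 'I_4 -> R) :
  (forall e t i j, in_edge e t i j -> F e t i j = G t i j) ->
  \sum_e \sum_t \sum_(i < 4) \sum_(j < 4 | (i < j)%N && in_edge e t i j) F e t i j
  = \sum_t \sum_(i < 4) \sum_(j < 4 | (i < j)%N) G t i j.
Proof.
move=> FG; rewrite exchange_big /=; apply: eq_bigr => t _.
rewrite exchange_big /=; apply: eq_bigr => i _.
rewrite (exchange_big_dep (fun j : 'I_4 => (i < j)%N)) /= => [|e j _ /andP[]//].
apply: eq_bigr => j ij; have neq : i != j by rewrite -val_eqE /= neq_ltn ij.
rewrite (eq_bigl (pred1 (edge t neq))) => [|e /=]; last by rewrite ij in_edgeE.
by rewrite big_pred1_eq FG // in_edgeE.
Qed.

End Gluing.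

(** * Rigidity of the glued metric *)

Section Rigidity.
Variables (R : realType) (T : triangulation) (hyp : type13 T).
Variables m1 m2 : polyhedral_metric R hyp.

Local Notation length_diff t i j :=
  (edge_length (realization m1 t) i j - edge_length (realization m2 t) i j).

(** Equal curvatures make the pairings of all tetrahedra sum to 0; as none is negative, each
    vanishes. *)
Lemma length_diff_ideal : curvature m1 = curvature m2 ->
  forall t i j, i != hyp t -> j != hyp t -> i != j ->
  length_diff t i j = length_diff t (hyp t) i + length_diff t (hyp t) j.
Proof.
move=> curvE t0 i0 j0 ih jh ij.
(* The terms [2 * pi] and [pi] depend only on the triangulation and cancel. *)
have coneE e : cone_angle m1 e = cone_angle m2 e.
  by have := congr1 (@^~ e) curvE; rewrite /curvature => /addrI/oppr_inj.
have pairing_ge0 t : 0 <= length_angle_pairing (realization m1 t) (realization m2 t).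
  have [b] := @fresh_label [:: hyp t] isT; rewrite inE eq_sym.
  move=> /complete_labels[k [l labels]].
  exact: (length_angle_pairing_ge0 _ _ labels).1.
have sum0 : \sum_t length_angle_pairing (realization m1 t) (realization m2 t) = 0.
  pose F (e : E T) t i j := (len m1 e - len m2 e)
    * (dihedral_angle (realization m1 t) i j - dihedral_angle (realization m2 t) i j).
  rewrite -(sum_edges (F := F)) => [|e t i j ije]; last first.
    by rewrite /F -(lenP m1 ije) -(lenP m2 ije).
  apply: big1 => e _.
  transitivity ((len m1 e - len m2 e) * (cone_angle m1 e - cone_angle m2 e)).
    rewrite /cone_angle -sumrB mulr_sumr; apply: eq_bigr => t _.
    rewrite -sumrB mulr_sumr; apply: eq_bigr => i _.
    by rewrite -sumrB mulr_sumr.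
  by rewrite coneE subrr mulr0.
have [a] := @fresh_label [:: hyp t0; i0; j0] isT.
rewrite !inE !negb_or => /and3P[ah ai aj].
have labels : uniq [:: hyp t0; a; i0; j0].
  by rewrite /= !inE !negb_or ![hyp t0 == _]eq_sym ah ih jh ai aj ij.
have [_] := length_angle_pairing_ge0 (realization m1 t0) (realization m2 t0) labels.
by apply; exact: (psumr_eq0P (fun t _ => pairing_ge0 t) sum0 isT).
Qed.

(* The horosphere at i has to be moved by the change of the length of the edge
   from i to the hyperideal vertex. *)
Definition decoration_change t i : R :=
  if i == hyp t then 0 else length_diff t (hyp t) i.

Hypothesis curvE : curvature m1 = curvature m2.

Lemma length_diffE t i j : i != j ->
  length_diff t i j = decoration_change t i + decoration_change t j.
Proof.
move=> ij; rewrite /decoration_change.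
have [ih|ih] := eqVneq i (hyp t); have [jh|jh] := eqVneq j (hyp t).
- by rewrite ih jh eqxx in ij.
- by rewrite ih add0r.
- by rewrite jh addr0 !(edge_lengthC _ i).
- exact: length_diff_ideal.
Qed.

Lemma length_diff_glued t f t' (g : {perm 'I_4}) i j :
  mate t f = Some (t', g) -> i != f -> j != f -> i != j ->
  length_diff t i j = length_diff t' (g i) (g j).
Proof.
move=> fE fi fj ij.
have e_in : in_edge (edge t ij) t i j by rewrite in_edgeE.
have e_in' := in_edge_glued fE fi fj e_in.
by rewrite !(lenP _ e_in) !(lenP _ e_in').
Qed.

(** The glued face has three vertices, and edge lengths fix the pairwise sums of the values there;
    three pairwise sums determine the three values. *)
Lemma decoration_change_glued t f t' (g : {perm 'I_4}) i :
  mate t f = Some (t', g) -> i != f ->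
  decoration_change t i = decoration_change t' (g i).
Proof.
move=> fE fi.
rewrite eq_sym in fi; have [j [k labels]] := complete_labels fi.
have /and4P[] := labels; rewrite !inE !negb_or ![f == _]eq_sym.
move=> /and3P[{}fi fj fk] /andP[ij ik] jk _.
have gneq (a b : 'I_4) : a != b -> g a != g b by rewrite (inj_eq perm_inj).
have := length_diff_glued fE fi fj ij;
  rewrite (length_diffE t ij) (length_diffE t' (gneq _ _ ij)).
have := length_diff_glued fE fi fk ik;
  rewrite (length_diffE t ik) (length_diffE t' (gneq _ _ ik)).
have := length_diff_glued fE fj fk jk;
  rewrite (length_diffE t jk) (length_diffE t' (gneq _ _ jk)).
move: (decoration_change t i) (decoration_change t j) (decoration_change t k).
move: (decoration_change t' (g i)) (decoration_change t' (g j)) (decoration_change t' (g k)).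
by move=> *; lra.
Qed.

(** Induction along a chain of gluings makes the change of decoration a function on [V T]. *)
Lemma decoration_change_vertex t i t' i' : vertex t i = vertex t' i' ->
  decoration_change t i = decoration_change t' i'.
Proof.
move=> /(congr1 val) /= E.
have : (t', [set i']%SET) \in cell_class (t, [set i]%SET) by rewrite E inE.
rewrite inE => /connectP[s]; elim: s t i {E} => [|x s IH] t i /=.
  by move=> _ [-> /finset.set1_inj ->].
move=> /andP[/gluedP[f [t2 [g [fE fi ->]]]]]; rewrite /= imset_set1 => ps lastE.
rewrite (decoration_change_glued fE); first exact: IH ps lastE.
by move: fi; rewrite inE eq_sym.
Qed.

End Rigidity.

Theorem theorem1p1 (R : realType) (T : triangulation) (hyp : type13 T)
    (m1 m2 : polyhedral_metric R hyp) :
  curvature m1 = curvature m2 ->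
  exists w : V T -> R,
    (forall v : V T, hyperideal_vertex hyp v -> w v = 0) /\
    (forall (e : E T) (t : tetra T) (i j : 'I_4), in_edge e t i j ->
       len m1 e = len m2 e + w (vertex t i) + w (vertex t j)).
Proof.
move=> curvE.
(* The choice of a representative is harmless by [decoration_change_vertex]. *)
pose w (v : V T) := if [pick x : tetra T * 'I_4 | v == vertex x.1 x.2] is Some x
  then decoration_change m1 m2 x.1 x.2 else 0.
have wE t i : w (vertex t i) = decoration_change m1 m2 t i.
  rewrite /w; case: pickP => [[t' i'] /= /eqP E | /(_ (t, i))]; last by rewrite eqxx.
  by rewrite (decoration_change_vertex curvE E).
exists w; split=> [v /existsP[t /eqP->]|e t i j ije].
  by rewrite wE /decoration_change eqxx.
rewrite !wE -(lenP m1 ije) -(lenP m2 ije) -addrA.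
by rewrite -(length_diffE curvE) ?subrKC // (in_edge_neq ije).
Qed.
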